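(* Let $\Omega \subset \mathbb{R}^N$ ($N\ge 2$) be a bounded measurable set with $|\Omega|>0$. Then for every $k \in \mathbb{N}$ and every $n \in \{1,\dots,k\}$ there exists an $n$-adjusted Cheeger $k$-tuple of $\Omega$.
   Context: $|\cdot|$ is Lebesgue measure and $P(E)=P(E;\mathbb{R}^N)$ is the distributional (De Giorgi) perimeter. For a measurable $D$ with $|D|>0$, $h_1(D)=\inf\{P(E)/|E| : E\subset D,\ |E|>0\}$. $\mathcal{E}_k(D)$ denotes the family of $k$-tuples $(E_1,\dots,E_k)$ of measurable subsets of $D$ with $|E_i|>0$ for all $i$ and $E_i\cap E_j=\emptyset$ for $i\ne j$, and $h_k(D)=\inf_{(E_1,\dots,E_k)\in\mathcal{E}_k(D)}\max_{i} P(E_i)/|E_i|$ (equivalently $\inf \max_i h_1(E_i)$). A Cheeger $k$-tuple of $D$ is an element of $\mathcal{E}_k(D)$ attaining this infimum. For $n\in\{1,\dots,k\}$, a Cheeger $k$-tuple $(E_1,\dots,E_k)$ of $\Omega$ is called $n$-adjusted if for every $l\in\{1,\dots,n\}$ and every choice of mutually distinct indices $i_1,\dots,i_l\in\{1,\dots,k\}$, the $l$-tuple $(E_{i_1},\dots,E_{i_l})$ is a Cheeger $l$-tuple of $\Omega\setminus\bigcup_{j\notin\{i_1,\dots,i_l\}}E_j$. (In particular, $1$-adjusted means each $E_i$ is a Cheeger set of $\Omega\setminus\bigcup_{j\neq i}E_j$, i.e. $h_1(\Omega\setminus\bigcup_{j\ne i}E_j)=h_1(E_i)=P(E_i)/|E_i|$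 for all $i$.) *)

(* Defs.v *)
From HB Require Import structures.
From mathcomp Require Import all_boot all_order all_algebra.
From mathcomp Require Import all_classical all_reals all_analysis.
Set Implicit Arguments. Unset Strict Implicit. Unset Printing Implicit Defensive.
Import Order.TTheory GRing.Theory Num.Theory.
Import numFieldNormedType.Exports.
Local Open Scope classical_set_scope.
Local Open Scope ring_scope.

Section Lebesgue.
Context (R : realType) (N : nat).

(* an alias of R^N carrying the discrete sigma-algebra (all subsets);
   it is only used as a carrier for the outer-measure construction mu_ext *)
Definition rVall : Type := 'rV[R]_N.
HB.instance Definition _ := Pointed.on rVall.
HB.instance Definition _ := @isMeasurable.Build default_measure_display
  rVall discrete_measurable discrete_measurable0
  discrete_measurableC discrete_measurableU.

Definition box (a b : 'rV[R]_N) : set rVall :=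
  [set x : rVall | forall i, a ord0 i <= (x : 'rV[R]_N) ord0 i < b ord0 i].

Definition box_vol (a b : 'rV[R]_N) : R :=
  \prod_(i < N) Num.max (b ord0 i - a ord0 i) 0.

Definition box_content (B : set rVall) : \bar R :=
  if `[< B = set0 >] then 0%E else
  ereal_inf [set (box_vol ab.1 ab.2)%:E | ab in [set ab | box ab.1 ab.2 = B]].

Lemma box_content0 : box_content set0 = 0%E.
Proof. by rewrite /box_content asboolT. Qed.

Lemma box_content_ge0 B : (0 <= box_content B)%E.
Proof.
rewrite /box_content; case: asboolP => // _.
apply: le_ereal_inf_tmp => _ [ab _ <-]; rewrite lee_fin.
by apply: prodr_ge0 => i _; rewrite le_max lexx orbT.
Qed.

Definition leb_outer : set rVall -> \bar R := mu_ext box_content.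

HB.instance Definition _ := isOuterMeasure.Build R rVall leb_outer
  (mu_ext0 box_content0 box_content_ge0) (mu_ext_ge0 box_content_ge0)
  (le_mu_ext box_content) (mu_ext_sigma_subadditive box_content_ge0).

End Lebesgue.

Section Cheeger.
Context (R : realType) (N : nat).
Local Open Scope ereal_scope.

Definition leb_space : Type := caratheodory_type (@leb_outer R N).
Definition leb : set leb_space -> \bar R := (@leb_outer R N : set leb_space -> \bar R).

Definition coord (x : leb_space) (i : 'I_N) : R := (x : 'rV[R]_N) ord0 i.

Definition divergence (phi : 'rV[R]_N -> 'rV[R]_N) (x : 'rV[R]_N) : R :=
  (\sum_(i < N) ('D_(delta_mx ord0 i) phi x) ord0 i)%R.

Definition admissible_field (phi : 'rV[R]_N -> 'rV[R]_N) : Prop :=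
  [/\ forall x, differentiable phi x,
      forall v, continuous ('D_v phi),
      compact (closure [set x | phi x != 0%R]) &
      forall x, (\sum_(i < N) (phi x ord0 i) ^+ 2 <= 1)%R].

Definition perimeter (E : set leb_space) : \bar R :=
  ereal_sup [set \int[leb]_(x in E) (divergence phi x)%:E | phi in admissible_field].

Definition ratio (E : set leb_space) : \bar R :=
  perimeter E * ((fine (leb E))^-1)%:E.

Definition Ek (D : set leb_space) (k : nat) (E : 'I_k -> set leb_space) : Prop :=
  (forall i, [/\ measurable (E i), E i `<=` D & 0 < leb (E i)]) /\
  (forall i j, i != j -> E i `&` E j = set0).

Definition maxratio (k : nat) (E : 'I_k -> set leb_space) : \bar R :=
  \big[maxe/-oo]_(i < k) ratio (E i).

Definition hk (D : set leb_space) (k : nat) : \bar R :=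
  ereal_inf [set maxratio E | E in @Ek D k].

Definition cheeger_tuple (D : set leb_space) (k : nat) (E : 'I_k -> set leb_space) : Prop :=
  @Ek D k E /\ maxratio E = hk D k.

Definition n_adjusted (Om : set leb_space) (k n : nat) (E : 'I_k -> set leb_space) : Prop :=
  cheeger_tuple Om E /\
  forall (l : nat) (s : 'I_l -> 'I_k), (1 <= l <= n)%N -> injective s ->
    cheeger_tuple (Om `\` \bigcup_(j in ~` range s) E j) (E \o s).

Definition bounded_rN (Om : set leb_space) : Prop :=
  exists M : R, forall x, Om x -> forall i, (`|coord x i| <= M)%R.

End Cheeger.

(* Main.v *)
Require Import Defs.
From HB Require Import structures.
From mathcomp Require Import all_boot all_order all_algebra.
From mathcomp Require Import all_classical all_reals all_analysis.
From mathcomp Require Import measurable_realfun ring lra.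
Set Implicit Arguments. Unset Strict Implicit. Unset Printing Implicit Defensive.
Import Order.TTheory GRing.Theory Num.Theory.
Import numFieldNormedType.Exports.
Local Open Scope classical_set_scope.
Local Open Scope ring_scope.

(* Among the vectors r that dominate the ratios of an admissible k-tuple, take a
   leximin one: minimize the largest entry, then the second largest, and so on.
   If some l of the sets did not form a Cheeger l-tuple of the complement of the
   others, replacing them by a better l-tuple would produce a leximin-smaller
   vector; so the tuple is n-adjusted for every n at once.

   The leximin exists because the set of these vectors is closed. This rests on
   the compactness of sets of bounded perimeter in a cube, obtained from a dyadic
   Poincare inequality. Halve the cells of the cube along their longest side c:
   the field e_c times the sum over the cells of (+-) a tent function in x_c has
   divergence (+-)(1_left - 1_right) and norm at most the half-width, so the sum of
   ||E & left| - |E & right|| is at most halfwidth * P(E). Summing over the levels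
   bounds the L^1 distance of 1_E to its cell averages by spread * P(E), uniformly
   in E. Applied to a set with P(E) <= lam |E| the same inequality bounds |E| from
   below, so no set of the tuple vanishes in the limit. If no subset of positive
   measure has finite perimeter, every ratio is infinite and any tuple will do;
   otherwise cutting one such subset by dyadic cells gives a tuple of finite
   ratios. *)

(** * Lebesgue measure of boxes *)

(** The entries of r are upper bounds rather than the ratios themselves because the perimeter is
    only lower semicontinuous: ratios may drop in the limit, so the exact ratio vectors need not
    form a closed set. Minimizing the largest ratio alone would leave the smaller ones uncontrolled.
    A better l-tuple may raise some of the replaced entries, but all of them stay below one old
    entry, and that is already an improvement in the leximin order.

    Halving one side at a time lets a field with a single nonzero component compare the two halves
    of a cell. The telescoped inequality relates a level only to later levels; that the oscillation
    of a fixed set tends to 0 is a separate fact, proved by approximation with finite unions of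
    boxes. The level at which it becomes small depends on the set, but disappears from the final
    bound.

    Since the measure is the Caratheodory measure of an outer measure built on half-open boxes, even
    the volume of a box has to be derived from countable covers. *)

Lemma length_split (R : realType) (u v c : R) :
  Num.max (Num.min v c - u) 0 + Num.max (v - Num.max u c) 0 <= Num.max (v - u) 0.
Proof.
have maxE (t : R) : Num.max t 0 = if t <= 0 then 0 else t by case: (leP t 0).
rewrite !maxE; case: (leP v c) => ?; case: (leP u c) => ?.
all: do ?(case: ifPn; rewrite -?ltNge => ?); lra.
Qed.

Section LebesgueBoxes.
Context (R : realType) (N : nat).
Local Notation V := 'rV[R]_N.
Local Notation T := (leb_space R N).

Local Notation outer :=
  (@leb_outer R N : {outer_measure set (rVall R N) -> \bar R}).

HB.instance Definition _ := isMeasure.Build _ T R (@leb R N)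
  (@caratheodory_measure0 _ _ outer) (@caratheodory_measure_ge0 _ _ outer)
  (@caratheodory_measure_sigma_additive _ _ outer).

Definition halfspace (i : 'I_N) (c : R) : set T := [set x | (x : V) ord0 i < c].

Definition setrow (a : V) (i : 'I_N) (t : R) : V :=
  \row_j (if j == i then t else a ord0 j).

Lemma setrowE a i t j : setrow a i t ord0 j = if j == i then t else a ord0 j.
Proof. by rewrite mxE. Qed.

Lemma box_vol_setrow (a b : V) i s t :
  box_vol (setrow a i s) (setrow b i t) =
  Num.max (t - s) 0 * \prod_(j < N | j != i) Num.max (b ord0 j - a ord0 j) 0.
Proof.
rewrite /box_vol (bigD1 i) //= !setrowE eqxx; congr (_ * _).
by apply: eq_bigr => j /negPf ji; rewrite !setrowE ji.
Qed.

Lemma setrow_id (a : V) i : setrow a i (a ord0 i) = a.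
Proof. by apply/rowP => j; rewrite setrowE; case: eqP => // ->. Qed.

Lemma box_volE (a b : V) i : box_vol a b = Num.max (b ord0 i - a ord0 i) 0 *
  \prod_(j < N | j != i) Num.max (b ord0 j - a ord0 j) 0.
Proof. by rewrite -{1}(setrow_id a i) -{1}(setrow_id b i) box_vol_setrow. Qed.

Lemma box_vol_setl (a b : V) i s : box_vol (setrow a i s) b =
  Num.max (b ord0 i - s) 0 * \prod_(j < N | j != i) Num.max (b ord0 j - a ord0 j) 0.
Proof. by rewrite -{1}(setrow_id b i) box_vol_setrow. Qed.

Lemma box_vol_setr (a b : V) i t : box_vol a (setrow b i t) =
  Num.max (t - a ord0 i) 0 * \prod_(j < N | j != i) Num.max (b ord0 j - a ord0 j) 0.
Proof. by rewrite -{1}(setrow_id a i) box_vol_setrow. Qed.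

Lemma box_content_box (a b : V) : (box_content (box a b) <= (box_vol a b)%:E)%E.
Proof.
rewrite /box_content; case: asboolP => _.
  by rewrite lee_fin; apply: prodr_ge0 => i _; rewrite le_max lexx orbT.
by apply: ereal_inf_lbound; exists (a, b).
Qed.

Lemma boxI_lt (a b : V) i c : box a b `&` halfspace i c =
  box a (setrow b i (Num.min (b ord0 i) c)).
Proof.
apply/seteqP; split=> [x [abx xc] j|x abx].
  rewrite setrowE; case: eqP => [->|_]; last exact: abx.
  by have /andP[-> xb] := abx i; rewrite lt_min xb.
split=> [j|]; last first.
  by have := abx i; rewrite setrowE eqxx lt_min => /and3P[].
have := abx j; rewrite setrowE; case: eqP => [->|_] //.
by rewrite lt_min => /and3P[-> ->].
Qed.

Lemma boxI_ge (a b : V) i c : box a b `&` ~` halfspace i c =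
  box (setrow a i (Num.max (a ord0 i) c)) b.
Proof.
apply/seteqP; split=> [x [abx /negP xc] j|x abx].
  rewrite setrowE; case: eqP => [->|_]; last exact: abx.
  by have /andP[ax ->] := abx i; rewrite ge_max ax andbT leNgt.
split=> [j|]; last first.
  have := abx i; rewrite setrowE eqxx ge_max => /andP[/andP[_ cx] _].
  by apply/negP; rewrite -leNgt.
have := abx j; rewrite setrowE; case: eqP => [->|_] //.
by rewrite ge_max => /andP[/andP[-> _] ->].
Qed.

(** Only boxes matter: for a nonempty set that is not a box, the infimum defining the content is
    over the empty set, hence infinite. A half-space cuts a box into two boxes whose volumes add
    up. *)
Lemma box_content_split (B : set (rVall R N)) i c :
  (box_content (B `&` halfspace i c) + box_content (B `&` ~` halfspace i c)
   <= box_content B)%E.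
Proof.
have [->|/set0P B0] := eqVneq B set0.
  by rewrite !set0I box_content0 adde0.
rewrite [leRHS]/box_content asboolF; last exact/eqP/set0P.
apply: le_ereal_inf_tmp => _ [[a b] /= <- <-].
rewrite boxI_lt boxI_ge; apply: (le_trans (leeD (box_content_box _ _) (box_content_box _ _))).
rewrite -EFinD lee_fin box_vol_setl box_vol_setr (box_volE a b i) -mulrDl.
apply: ler_wpM2r; first by apply: prodr_ge0 => j _; rewrite le_max lexx orbT.
exact: length_split.
Qed.

(** Caratheodory's criterion: cutting every member of a cover by the half-space gives covers of the
    two pieces, at no greater total cost by [box_content_split]. *)
Lemma measurable_halfspace i c : measurable (halfspace i c).
Proof.
apply: le_caratheodory_measurable => X.
apply: le_ereal_inf_tmp => _ [F [mF XF] <-].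
have H0 A : (0 <= box_content (A : set (rVall R N)))%E by exact: box_content_ge0.
apply: (@le_trans _ _ (\sum_(k <oo) box_content (F k `&` halfspace i c) +
    \sum_(k <oo) box_content (F k `&` ~` halfspace i c))%E).
  apply: leeD; apply: ereal_inf_lbound; eexists; try reflexivity; split => //.
    by rewrite -setI_bigcupl; apply: setSI.
  by rewrite -setI_bigcupl; apply: setSI.
rewrite -nneseriesD //; apply: lee_nneseries => *.
  exact: adde_ge0.
exact: box_content_split.
Qed.

Lemma measurable_box (a b : V) : measurable (box a b : set T).
Proof.
have -> : (box a b : set T) = \bigcap_(i in [set: 'I_N])
    (halfspace i (b ord0 i) `\` halfspace i (a ord0 i)).
  apply/seteqP; split=> [x abx i _|x abx i].
    by have /andP[ax xb] := abx i; split => //; apply/negP; rewrite -leNgt.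
  by have [bx /negP] := abx i I; rewrite -leNgt => -> /=.
apply: fin_bigcap_measurable => [|i _]; first exact: finite_finset.
by apply: measurableD; exact: measurable_halfspace.
Qed.

Lemma leb_box_le (a b : V) : (leb (box a b) <= (box_vol a b)%:E)%E.
Proof.
apply: le_trans (box_content_box a b).
have H0 A : (0 <= box_content (A : set (rVall R N)))%E by exact: box_content_ge0.
apply: ereal_inf_lbound; exists (fun n => if n is 0 then box a b else set0).
  by split => // x abx; exists 0.
rewrite nneseries_recl //; first by rewrite eseries0 ?adde0 // => -[|n] // _ _; exact: box_content0.
Qed.

(* The indicator of the box with its first n coordinates integrated out. *)
Definition slice (n : nat) (a b x : V) : R := \prod_(i < N)
  if (i < n)%N then Num.max (b ord0 i - a ord0 i) 0
  else \1_`[a ord0 i, b ord0 i[ (x ord0 i).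

Lemma slice_ge0 n a b x : 0 <= slice n a b x.
Proof.
by apply: prodr_ge0 => i _; case: ifP => _; rewrite ?le_max ?lexx ?orbT.
Qed.

Lemma integral_slice n (ltnN : (n < N)%N) (a b x : V) :
  (\int[lebesgue_measure]_t
     (slice n a b (setrow x (Ordinal ltnN) t))%:E = (slice n.+1 a b x)%:E)%E.
Proof.
set j := Ordinal ltnN.
pose C := \prod_(i < N | i != j)
  if (i < n)%N then Num.max (b ord0 i - a ord0 i) 0
  else \1_`[a ord0 i, b ord0 i[ (x ord0 i).
have C0 : 0 <= C.
  by apply: prodr_ge0 => i _; case: ifP => _; rewrite ?le_max ?lexx ?orbT.
under eq_integral => t _.
  rewrite /slice (bigD1 j) //= ltnn setrowE eqxx.
  rewrite (eq_bigr (fun i : 'I_N => if (i < n)%N then Num.max (b ord0 i - a ord0 i) 0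
  else \1_`[a ord0 i, b ord0 i[ (x ord0 i))); last first.
    by move=> i /negPf ij; rewrite setrowE ij.
  rewrite -/C mulrC EFinM.
  over.
rewrite ge0_integralZl_EFin //; last first.
  by apply/measurable_EFinP.
rewrite integral_indic // setIT /= lebesgue_measure_itv /=.
rewrite /slice (bigD1 j) //= ltnSn mulrC.
rewrite [in RHS](eq_bigr (fun i : 'I_N => if (i < n)%N then Num.max (b ord0 i - a ord0 i) 0
  else \1_`[a ord0 i, b ord0 i[ (x ord0 i))); last first.
  move=> i ij; rewrite ltnS leq_eqVlt; case: eqP => // inj.
  by move: ij; rewrite -val_eqE /= inj eqxx.
rewrite -/C EFinM; congr (_ * _)%E.
rewrite lte_fin; case: ltP => ab; first by rewrite max_l // subr_ge0 ltW.
by rewrite max_r // subr_le0.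
Qed.

(** Fubini by induction, with one-dimensional integrals only: the pointwise bound between indicators
    is integrated over one coordinate at a time, and each integral passes through the series by
    monotone convergence. The weights [c] allow members of a cover to be discarded. *)
Lemma slice_le_series (a b : V) (A B : nat -> V) (c : nat -> R) :
  (forall k, 0 <= c k) ->
  (forall x, ((slice 0 a b x)%:E <= \sum_(k <oo) (c k * slice 0 (A k) (B k) x)%:E)%E) ->
  ((box_vol a b)%:E <= \sum_(k <oo) (c k * box_vol (A k) (B k))%:E)%E.
Proof.
move=> c0 H0.
have volE a' b' : box_vol a' b' = slice N a' b' 0.
  by apply: eq_bigr => i _; rewrite ltn_ord.
rewrite volE; under eq_eseriesr do rewrite volE.
suff H n : (n <= N)%N -> forall x, ((slice n a b x)%:E <=
    \sum_(k <oo) (c k * slice n (A k) (B k) x)%:E)%E by exact: H.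
elim: n => // n IH ltnN x.
have mslice a' b' : measurable_fun [set: R]
    (fun t => (slice n a' b' (setrow x (Ordinal ltnN) t))%:E).
  apply/measurable_EFinP.
  apply: (@measurable_prod _ _ _ _ _ _ (fun (i : 'I_N) (t : R) =>
    if (i < n)%N then Num.max (b' ord0 i - a' ord0 i) 0 else \1_`[a' ord0 i, b' ord0 i[ (setrow x (Ordinal ltnN) t ord0 i))) => i _.
  case: (boolP (i < n)%N) => _ /=; first exact: measurable_cst.
  under eq_fun do rewrite setrowE.
  by case: (i == _); [exact: measurable_indic|exact: measurable_cst].
rewrite -integral_slice.
have intE k : ((c k * slice n.+1 (A k) (B k) x)%:E = \int[lebesgue_measure]_t
    (c k * slice n (A k) (B k) (setrow x (Ordinal ltnN) t))%:E)%E.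
  rewrite EFinM -integral_slice -ge0_integralZl_EFin //.
    by move=> *; rewrite lee_fin slice_ge0.
  exact: mslice.
under eq_eseriesr do rewrite intE.
rewrite /= -integral_nneseries //.
- apply: ge0_le_integral => //.
  + by move=> *; rewrite lee_fin slice_ge0.
  + exact: mslice.
  + apply: ge0_emeasurable_sum => [k t _ _|k _].
      by rewrite lee_fin mulr_ge0 // slice_ge0.
    by under eq_fun do rewrite EFinM; apply: measurable_funeM; exact: mslice.
  + by move=> t _; exact: (IH (ltnW ltnN)).
- by move=> k; under eq_fun do rewrite EFinM; apply: measurable_funeM; exact: mslice.
- by move=> k t _; rewrite lee_fin mulr_ge0 // slice_ge0.
Qed.

Lemma slice0 (a b x : V) : slice 0 a b x = \1_(box a b : set T) x.
Proof.
rewrite /slice indicE; case: (asboolP (x \in (box a b : set T))) => [|/negP].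
  rewrite inE => abx; rewrite mem_set // big1 // => i _ /=.
  by rewrite indicE mem_set //= in_itv; exact: abx.
move=> abx; rewrite (negPf abx).
have /existsNP[i abxi] : ~ box a b x by move=> ?; case/negP: abx; rewrite inE.
rewrite (bigD1 i) //= indicE memNset ?mul0r //= in_itv; exact: abxi.
Qed.

(** A cover by one box, all other weights being 0. As a consequence, all pairs of corners describing
    the same box give the same volume, so the infimum in [box_content] is over a single value. *)
Lemma box_vol_mono (a b a' b' : V) :
  (box a b : set T) `<=` box a' b' -> box_vol a b <= box_vol a' b'.
Proof.
move=> ab; rewrite -lee_fin.
have -> : (box_vol a' b')%:E =
    (\sum_(k <oo) ((k == 0%N)%:R * box_vol a' b')%:E)%E.
  rewrite nneseries_recl //; first by rewrite mul1r eseries0 ?adde0 // => -[|k] //; rewrite mul0r.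
  by move=> k _; rewrite lee_fin mulr_ge0 // prodr_ge0 // => i _; rewrite le_max lexx orbT.
apply: (@slice_le_series _ _ (fun=> a') (fun=> b')) => // x.
rewrite nneseries_recl //; last by move=> k _; rewrite lee_fin mulr_ge0 // slice_ge0.
rewrite eseries0 ?adde0 => [|[|k] //]; last by rewrite mul0r.
rewrite mul1r !slice0 lee_fin !indicE; case: (boolP (x \in (box a b : set T))) => //.
by rewrite inE => /ab ?; rewrite mem_set.
Qed.

Lemma leb_box (a b : V) : leb (box a b) = (box_vol a b)%:E.
Proof.
apply/eqP; rewrite eq_le leb_box_le /=.
apply: le_ereal_inf_tmp => _ [F [_ abF] <-].
have H0 A : (0 <= box_content (A : set (rVall R N)))%E by exact: box_content_ge0.
have [[k Fk]|/forallNP Foo] := pselect (exists k, box_content (F k) = +oo%E).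
  rewrite (eseries_pinfty _ _ Fk) ?leey // => n _.
  by rewrite -ltNye (lt_le_trans _ (H0 _)).
(* A member of finite content is empty or a box; it gets weight 0 in the first case and 1 in the
   second. *)
have /choice[G HG] k : exists g : R * (V * V), [/\ 0 <= g.1,
    ((g.1 * box_vol g.2.1 g.2.2)%:E <= box_content (F k))%E &
    forall x, F k x -> 1 <= g.1 * \1_(box g.2.1 g.2.2 : set T) x].
  have [->|/set0P Fk0] := eqVneq (F k) set0.
    by exists (0, (0, 0)); split => //; rewrite mul0r box_content0.
  move: (Foo k); rewrite /box_content asboolF; last by apply/eqP/set0P.
  have [[[a' b'] /= Fk]|nFk] := pselect (exists ab, box ab.1 ab.2 = F k); last first.
    suff -> : [set ab | box ab.1 ab.2 = F k] = set0 by rewrite image_set0 ereal_inf0.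
    by rewrite -subset0 => ab abF'; case: nFk; exists ab.
  move=> _; exists (1, (a', b')); split => //=.
    rewrite mul1r; apply: le_ereal_inf_tmp => _ [[a2 b2] /= Fk2 <-].
    by rewrite lee_fin; apply: box_vol_mono; rewrite Fk -Fk2.
  by move=> x; rewrite -Fk => Fx; rewrite indicE mem_set // mulr1.
apply: (@le_trans _ _ (\sum_(k <oo) ((G k).1 * box_vol (G k).2.1 (G k).2.2)%:E)%E).
  apply: slice_le_series => [k|x]; first by case: (HG k).
  rewrite slice0 indicE; case: (boolP (x \in (box a b : set T))) => xab; last first.
    by apply: nneseries_ge0 => k *; rewrite lee_fin mulr_ge0 ?slice_ge0 //; case: (HG k).
  move: xab; rewrite inE => /abF[k _ Fkx].
  apply: le_trans (nneseries_lim_ge k.+1 _); last first.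
    by move=> n *; rewrite lee_fin mulr_ge0 ?slice_ge0 //; case: (HG n).
  rewrite big_mkord big_ord_recr /= -[leLHS]add0e; apply: leeD.
    by apply: sume_ge0 => n _; rewrite lee_fin mulr_ge0 ?slice_ge0 //; case: (HG n).
  by rewrite lee_fin slice0; have [_ _] := HG k; exact.
apply: lee_nneseries => k *; last by case: (HG k).
rewrite lee_fin mulr_ge0 ?prodr_ge0 // => [|i _]; first by case: (HG k).
by rewrite le_max lexx orbT.
Qed.

End LebesgueBoxes.

(** * Dyadic cells *)

Section Dyadic.
Context (R : realType) (N : nat) (i0 : 'I_N) (a0 : 'rV[R]_N) (L : R) (L0 : 0 < L).
Local Notation V := 'rV[R]_N.
Local Notation T := (leb_space R N).

Definition widest (w : V) : 'I_N := [arg max_(i > i0) w ord0 i]%O.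

(** All cells of a level are translates of one another, so a single vector of side lengths describes
    the level and the side to be halved depends on the level alone. *)
Fixpoint width (l : nat) : V := if l is l'.+1 then
  setrow (width l') (widest (width l')) (width l' ord0 (widest (width l')) / 2)
  else const_mx L.

Definition axis l : 'I_N := widest (width l).
Definition halfwidth l : R := width l ord0 (axis l) / 2.
Definition sibling l (a : V) : V := setrow a (axis l) (a ord0 (axis l) + halfwidth l).
Definition spread l : R := \sum_i width l ord0 i.
Definition cellvol l : R := \prod_i width l ord0 i.

Lemma width_axis l : width l ord0 (axis l) = 2 * halfwidth l.
Proof. by rewrite /halfwidth mulrC divfK. Qed.

Lemma width_gt0 l i : 0 < width l ord0 i.
Proof.
elim: l i => [|l IH] i; first by rewrite mxE.
by rewrite setrowE; case: ifP => // _; rewrite divr_gt0.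
Qed.

Lemma halfwidth_gt0 l : 0 < halfwidth l. Proof. by rewrite divr_gt0 ?width_gt0. Qed.

Lemma cellvol_gt0 l : 0 < cellvol l.
Proof. by apply: prodr_gt0 => i _; exact: width_gt0. Qed.

Lemma width_le_spread l i : width l ord0 i <= spread l.
Proof.
by rewrite /spread (bigD1 i) //= lerDl; apply: sumr_ge0 => j _; exact/ltW/width_gt0.
Qed.

Lemma spread_ge0 l : 0 <= spread l.
Proof. by apply: sumr_ge0 => i _; exact/ltW/width_gt0. Qed.

(* The spread drops by exactly the length that is halved, so that the bounds
   [step_inequality] of the successive levels telescope. *)
Lemma spreadS l : spread l.+1 = spread l - halfwidth l.
Proof.
rewrite /spread (bigD1 (axis l)) //= [in RHS](bigD1 (axis l)) //= setrowE eqxx.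
rewrite (eq_bigr (fun i => width l ord0 i)) => [|i /negPf ia]; last first.
  by rewrite setrowE ia.
by rewrite -/(axis l) /halfwidth; lra.
Qed.

Lemma cellvolS l : cellvol l.+1 = cellvol l / 2.
Proof.
rewrite /cellvol (bigD1 (axis l)) //= [in RHS](bigD1 (axis l)) //= setrowE eqxx.
rewrite (eq_bigr (fun i => width l ord0 i)) => [|i /negPf ia]; last first.
  by rewrite setrowE ia.
by rewrite -/(axis l) mulrAC.
Qed.

(** The reason for halving a longest side: each of the [N] sides is at most [2 * halfwidth l], so
    every halving removes a fixed fraction of the spread. *)
Lemma spread_le_halfwidth l : spread l <= (2 * N)%:R * halfwidth l.
Proof.
have -> : (2 * N)%:R * halfwidth l = \sum_(i < N) width l ord0 (axis l).
  rewrite sumr_const card_ord -mulr_natl /halfwidth natrM; by field.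
rewrite /spread; apply: ler_sum => i _; rewrite /axis /widest.
by case: arg_maxP => // j _; apply.
Qed.

Lemma spread_geometric l : spread l <= (1 - (2 * N)%:R^-1) ^+ l * spread 0.
Proof.
have N0 : 0 < (2 * N)%:R :> R by rewrite ltr0n muln_gt0 /= (leq_ltn_trans _ (ltn_ord i0)).
elim: l => [|l IH]; first by rewrite expr0 mul1r.
rewrite spreadS exprS -mulrA.
have : spread l / (2 * N)%:R <= halfwidth l by rewrite ler_pdivrMr // mulrC spread_le_halfwidth.
have : 0 <= 1 - (2 * N)%:R^-1 :> R.
  by rewrite subr_ge0 invf_le1 // ler1n muln_gt0 /= (leq_ltn_trans _ (ltn_ord i0)).
move=> /ler_wpM2l /(_ _ _ IH); lra.
Qed.

Lemma spread_cvg0 : spread @ \oo --> (0 : R).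
Proof.
have N0 : 0 < (2 * N)%:R :> R by rewrite ltr0n muln_gt0 /= (leq_ltn_trans _ (ltn_ord i0)).
have N1 : 1 <= (2 * N)%:R :> R.
  by rewrite ler1n muln_gt0 /= (leq_ltn_trans _ (ltn_ord i0)).
apply: (@squeeze_cvgr _ _ _ _ (fun=> 0) (fun l => (1 - (2 * N)%:R^-1) ^+ l * spread 0)).
- by apply: nearW => l; rewrite spread_ge0 spread_geometric.
- exact: cvg_cst.
- rewrite -[X in _ --> X](mul0r (spread 0)); apply: cvgMl; apply: cvg_expr.
  by rewrite ger0_norm ?subr_ge0 ?invf_le1 // gtrBl invr_gt0.
Qed.

Lemma spread_small e : 0 < e -> exists l, spread l < e.
Proof.
move=> e0; have /cvgr0Pnorm_lt /(_ e e0) [l _ /(_ l (leqnn l))] := spread_cvg0.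
by rewrite ger0_norm ?spread_ge0 //; exists l.
Qed.

Definition cell l (a : V) : set T :=
  [set x | forall i, a ord0 i <= (x : V) ord0 i < a ord0 i + width l ord0 i].

Lemma cell_box l a : cell l a = box a (a + width l).
Proof. by apply/seteqP; split=> x xa i; have := xa i; rewrite mxE. Qed.

Lemma measurable_cell l a : measurable (cell l a).
Proof. by rewrite cell_box; exact: measurable_box. Qed.

Lemma leb_cell l a : leb (cell l a) = (cellvol l)%:E.
Proof.
rewrite cell_box leb_box /box_vol; congr _%:E; apply: eq_bigr => i _.
by rewrite mxE addrAC subrr add0r max_l // ltW // width_gt0.
Qed.

(** The left half of a cell keeps its corner, the right half gets the [sibling]. *)
Fixpoint corners l : seq V := if l is l'.+1 then
  flatten [seq [:: a; sibling l' a] | a <- corners l'] else [:: a0].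

Lemma big_corners (M : nmodType) l (F : V -> M) : \sum_(a <- corners l.+1) F a =
  \sum_(a <- corners l) (F a + F (sibling l a)).
Proof.
rewrite big_flatten big_map; apply: eq_bigr => a _.
by rewrite big_cons big_seq1.
Qed.

Lemma cell_left l a : cell l.+1 a = cell l a `&` halfspace (axis l) (a ord0 (axis l) + halfwidth l).
Proof.
apply/seteqP; split=> [x xa|x [xa xm] i].
  split=> [i|]; last by have /andP[_] := xa (axis l); rewrite setrowE eqxx.
  have := xa i; rewrite setrowE; case: eqP => // -> /andP[-> /lt_le_trans]; apply.
  by have := width_gt0 l (axis l); rewrite -/(axis l); lra.
have := xa i; rewrite setrowE; case: eqP => // -> /andP[-> _].
exact: xm.
Qed.

Lemma cell_right l a : cell l.+1 (sibling l a) =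
  cell l a `\` halfspace (axis l) (a ord0 (axis l) + halfwidth l).
Proof.
have w0 := halfwidth_gt0 l.
apply/seteqP; split=> [x xa|x [xa /negP xm] i].
  split=> [i|].
    have := xa i; rewrite !setrowE; case: eqP => // -> /andP[ax xb].
    rewrite (le_trans _ ax) ?lerDl ?ltW //=; move: xb; rewrite -/(axis l) /halfwidth; lra.
  have := xa (axis l); rewrite !setrowE eqxx => /andP[ax _].
  by apply/negP; rewrite -leNgt.
have := xa i; rewrite !setrowE; case: eqP => // -> /andP[_ xb].
by rewrite leNgt xm /=; move: xb; rewrite -/(axis l) /halfwidth; lra.
Qed.

Lemma cell_split l a : cell l a = cell l.+1 a `|` cell l.+1 (sibling l a).
Proof. by rewrite cell_left cell_right setUIDK. Qed.

Lemma cell_disj l a : cell l.+1 a `&` cell l.+1 (sibling l a) = set0.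
Proof. by rewrite cell_left cell_right setDE setIACA setICr setI0. Qed.

Lemma indic_cell l a (x : T) : \1_(cell l a) x =
  \1_(cell l.+1 a) x + \1_(cell l.+1 (sibling l a)) x :> R.
Proof.
rewrite !indicE cell_left cell_right in_setI in_setD.
by case: (x \in cell l a); case: (x \in halfspace _ _); rewrite /= ?addr0 ?add0r.
Qed.

Lemma sum_indic_corners l (x : T) :
  \sum_(a <- corners l) \1_(cell l a) x = \1_(cell 0 a0) x :> R.
Proof.
elim: l => [|l IH]; first by rewrite big_seq1.
by rewrite big_corners -IH; apply: eq_bigr => a _; rewrite -indic_cell.
Qed.

(** [fine] sends an infinite measure to 0; on measurable subsets of a cell nothing is lost, by
    [massE]. *)
Definition mass (E : set T) : R := fine (leb E).

Lemma leb_subcell_fin l a (E : set T) : measurable E -> E `<=` cell l a ->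
  leb E \is a fin_num.
Proof.
move=> mE Ea; rewrite ge0_fin_numE //.
have : (leb E <= leb (cell l a))%E.
  by apply: le_measure => //; rewrite inE //; exact: measurable_cell.
by rewrite leb_cell => /le_lt_trans; apply; rewrite ltry.
Qed.

Lemma massE l a (E : set T) : measurable E -> E `<=` cell l a ->
  (mass E)%:E = leb E.
Proof. by move=> mE Ea; rewrite fineK // (leb_subcell_fin mE Ea). Qed.

Lemma mass_ge0 (E : set T) : 0 <= mass E.
Proof. exact: fine_ge0. Qed.

Definition part (E : set T) l a : R := mass (E `&` cell l a).

Lemma part_ge0 E l a : 0 <= part E l a. Proof. exact: mass_ge0. Qed.

Lemma partE (E : set T) l a : measurable E -> (part E l a)%:E = leb (E `&` cell l a).
Proof.
move=> mE; apply: (@massE l a) => //.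
by apply: measurableI => //; exact: measurable_cell.
Qed.

Lemma part_le (E : set T) l a : measurable E -> part E l a <= cellvol l.
Proof.
move=> mE; rewrite -lee_fin partE // -(leb_cell l a).
by apply: le_measure; rewrite ?inE //; [apply: measurableI => //|]; exact: measurable_cell.
Qed.

Lemma part_split (E : set T) l a : measurable E ->
  part E l a = part E l.+1 a + part E l.+1 (sibling l a).
Proof.
move=> mE; apply: EFin_inj; rewrite EFinD !partE // cell_split setIUr measureU //.
- by apply: measurableI => //; exact: measurable_cell.
- by apply: measurableI => //; exact: measurable_cell.
- by rewrite setIACA cell_disj setI0.
Qed.

Lemma sum_part (E : set T) l : measurable E ->
  \sum_(a <- corners l) part E l a = part E 0 a0.
Proof.
move=> mE; elim: l => [|l IH]; first by rewrite big_seq1.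
by rewrite big_corners -IH; apply: eq_bigr => a _; rewrite -part_split.
Qed.

(* Each term is half the L^1 distance on a cell between the indicator of E and
   its mean value. *)
Definition oscillation (E : set T) l : R :=
  \sum_(a <- corners l) part E l a * (cellvol l - part E l a) / cellvol l.

(** On a cell of volume v whose halves contain masses x and y, the right side minus the left is (|x
    - y| v - (x - y)^2) / v, which is nonnegative because |x - y| <= v / 2. *)
Lemma oscillation_step (E : set T) l : measurable E ->
  oscillation E l <= oscillation E l.+1 +
    \sum_(a <- corners l) `|part E l.+1 a - part E l.+1 (sibling l a)|.
Proof.
move=> mE; rewrite /oscillation big_corners -big_split /=; apply: ler_sum => a _.
rewrite part_split // cellvolS.
have := part_ge0 E l.+1 a; have := part_ge0 E l.+1 (sibling l a).
have := part_le l.+1 a mE; have := part_le l.+1 (sibling l a) mE.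
rewrite cellvolS; have := cellvol_gt0 l.
move: (cellvol l) (part E l.+1 a) (part E l.+1 (sibling l a)) => v x y v0 yv xv y0 x0.
rewrite -subr_ge0.
have -> : x * (v / 2 - x) / (v / 2) + y * (v / 2 - y) / (v / 2) + `|x - y| -
  (x + y) * (v - (x + y)) / v = (`|x - y| * v - (x - y) ^+ 2) / v.
  by field; lra.
apply: divr_ge0; last exact: ltW.
rewrite -real_normK ?num_real // expr2 -mulrBr mulr_ge0 // subr_ge0.
by rewrite ler_norml; lra.
Qed.

End Dyadic.

(** * Continuously differentiable functions and test fields *)

Section C1.
Context (R : realType) (N : nat).
Local Notation V := 'rV[R]_N.

(** The scalar counterpart of the first two clauses of [admissible_field]. *)
Definition C1fun (f : V -> R) :=
  (forall x, differentiable f x) /\ (forall v, continuous ('D_v f)).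

Lemma C1_continuous f x : C1fun f -> {for x, continuous f}.
Proof. by move=> [df _]; exact/differentiable_continuous. Qed.

Lemma C1_cst c : C1fun (cst c).
Proof.
split=> [x|v]; first exact: differentiable_cst.
have -> : 'D_v (cst c : V -> R) = cst 0 by apply/funext => x; rewrite derive_cst.
exact: cst_continuous.
Qed.

Lemma derive_coord (i : 'I_N) (v x : V) : 'D_v (fun y : V => y ord0 i) x = v ord0 i.
Proof.
have @f : {linear V -> R} by exists (fun y : V => y ord0 i); do 2![eexists]; do ?[constructor];
  rewrite ?mxE // => ? *; rewrite ?mxE //; move=> ?; rewrite !mxE.
rewrite deriveE; last exact: differentiable_coord.
by rewrite (diff_lin _ (f := f)) //; exact: coord_continuous.
Qed.

Lemma C1_coord (i : 'I_N) : C1fun (fun x : V => x ord0 i).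
Proof.
split=> [x|v]; first exact: differentiable_coord.
have -> : 'D_v (fun y : V => y ord0 i) = cst (v ord0 i).
  by apply/funext => x; rewrite derive_coord.
exact: cst_continuous.
Qed.

Lemma C1D f g : C1fun f -> C1fun g -> C1fun (fun x => f x + g x).
Proof.
move=> [df cf] [dg cg]; split=> [x|v x]; first exact: differentiableD.
have -> : 'D_v (fun x => f x + g x) = (fun x => 'D_v f x + 'D_v g x).
  by apply/funext => y; rewrite (deriveD (diff_derivable (df y)) (diff_derivable (dg y))).
exact: (continuousD (cf v x) (cg v x)).
Qed.

Lemma deriveM_C1 f g (v x : V) : C1fun f -> C1fun g ->
  'D_v (fun x => f x * g x) x = f x * 'D_v g x + g x * 'D_v f x.
Proof.
by move=> [df _] [dg _]; rewrite (deriveM (diff_derivable (df x)) (diff_derivable (dg x))).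
Qed.

Lemma C1M f g : C1fun f -> C1fun g -> C1fun (fun x => f x * g x).
Proof.
move=> Cf Cg; have [df cf] := Cf; have [dg cg] := Cg.
split=> [x|v x]; first exact: differentiableM.
have -> : 'D_v (fun x => f x * g x) = (fun x => f x * 'D_v g x + g x * 'D_v f x).
  by apply/funext => y; exact: deriveM_C1.
have H1 : {for x, continuous (fun y => f y * 'D_v g y)} := continuousM (C1_continuous Cf) (cg v x).
have H2 : {for x, continuous (fun y => g y * 'D_v f y)} := continuousM (C1_continuous Cg) (cf v x).
exact: (continuousD H1 H2).
Qed.

Lemma C1_sum (I : Type) (s : seq I) (F : I -> V -> R) :
  (forall i, C1fun (F i)) -> C1fun (fun x => \sum_(i <- s) F i x).
Proof.
move=> CF; elim: s => [|i s IH].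
  by under eq_fun do rewrite big_nil; exact: C1_cst.
by under eq_fun do rewrite big_cons; exact: C1D.
Qed.

Lemma derive_sum_C1 (I : Type) (s : seq I) (F : I -> V -> R) v x :
  (forall i, C1fun (F i)) ->
  'D_v (fun x => \sum_(i <- s) F i x) x = \sum_(i <- s) 'D_v (F i) x.
Proof.
move=> CF; elim: s => [|i s IH].
  by under eq_fun do rewrite big_nil; rewrite derive_cst big_nil.
under eq_fun do rewrite big_cons.
rewrite big_cons -IH (deriveD (diff_derivable ((CF i).1 x))) //.
by apply: diff_derivable; exact: (C1_sum s CF).1.
Qed.

Lemma C1_prod (I : Type) (s : seq I) (P : pred I) (F : I -> V -> R) :
  (forall i, C1fun (F i)) -> C1fun (fun x => \prod_(i <- s | P i) F i x).
Proof.
move=> CF; elim: s => [|i s IH].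
  by under eq_fun do rewrite big_nil; exact: C1_cst.
under eq_fun do rewrite big_cons.
by case: (P i); [exact: (C1M (CF i) IH)|exact: IH].
Qed.

Lemma derive_comp1 (F dF : R -> R) (f : V -> R) (v x : V) :
  (forall y : R, is_derive y (1:R) F (dF y)) -> differentiable f x ->
  'D_v (fun x => F (f x)) x = dF (f x) * 'D_v f x.
Proof.
move=> HF df; have dFx : differentiable F (f x).
  by apply/derivable1_diffP; have [] := HF (f x).
rewrite deriveE; last exact: (differentiable_comp df dFx).
rewrite (diff_comp df dFx) /= diff1E //= derive1E.
have [_ ->] := HF (f x).
by rewrite deriveE // mulrC.
Qed.

Lemma C1_comp (F dF : R -> R) (f : V -> R) : (forall y : R, is_derive y (1:R) F (dF y)) ->
  continuous dF -> C1fun f -> C1fun (fun x => F (f x)).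
Proof.
move=> HF cdF Cf; have [df cf] := Cf; split=> [x|v x].
  apply: differentiable_comp => //.
  by apply/derivable1_diffP; have [] := HF (f x).
have -> : 'D_v (fun x => F (f x)) = (fun x => dF (f x) * 'D_v f x).
  by apply/funext => y; exact: derive_comp1.
have H : {for x, continuous (fun y => dF (f y))}.
  exact: (continuous_comp (C1_continuous Cf) (cdF (f x))).
exact: (continuousM H (cf v x)).
Qed.

Lemma derive_indep (f : V -> R) (i : 'I_N) x :
  (forall (y : V) t, f (y + t *: delta_mx ord0 i) = f y) -> 'D_(delta_mx ord0 i) f x = 0.
Proof.
move=> fi; apply: (cvg_lim (@Rhausdorff R)).
rewrite [X in X @ _](_ : _ = cst 0); first exact: cvg_cst.
by apply/funext => h /=; rewrite [h *: _ + x]addrC fi subrr scaler0.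
Qed.

End C1.

(** * Profiles of one real variable *)

Section SquaredPositivePart.
Context (R : realType).

(** The [C^1] building block of all test functions: cutoffs and tents are made from its translates,
    so their bounds reduce to piecewise polynomial arithmetic. *)
Definition sqp (y : R) : R := Num.max y 0 ^+ 2.

(** A quadratic remainder yields the derivative at every point, the kink of the positive part
    included. *)
Lemma sqp_taylor (y h : R) : `|sqp (h + y) - sqp y - 2 * Num.max y 0 * h| <= h ^+ 2.
Proof.
rewrite /sqp ler_norml; case: (leP y 0) => ?; case: (leP (h + y) 0) => ?.
all: by apply/andP; split; nra.
Qed.

Lemma is_derive_sqp (y : R) : is_derive y (1 : R) sqp (2 * Num.max y 0).
Proof.
have H : h^-1 *: (sqp (h *: 1 + y) - sqp y) @[h --> 0^'] --> 2 * Num.max y 0.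
  apply/cvgrPdist_le => e e0; near=> h.
  have h0 : h != 0 by near: h; exact: nbhs_dnbhs_neq.
  rewrite distrC -(ler_pM2l (x := `|h|)) ?normr_gt0 // -normrM mulrBr.
  rewrite [_ *: (_ - _)]/(_ * _) mulrA divff // mul1r [h *: 1]mulr1 [h * _]mulrC.
  apply: (le_trans (sqp_taylor _ _)); rewrite -real_normK ?num_real // expr2.
  rewrite ler_wpM2l //; near: h.
  by apply: (@cvgr0_norm_le _ _ _ _ _ id) => //; apply: cvg_within.
split; first by apply/cvg_ex; exists (2 * Num.max y 0).
exact: cvg_lim.
Unshelve. all: by end_near. Qed.

Definition posp (y : R) := 2 * Num.max y 0.

Lemma continuous_posp : continuous posp.
Proof.
move=> y.
have H : {for y, continuous (fun z : R => Num.max z 0)}.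
  apply: (@continuous_max R^o R id (fun=> 0)) => //.
  exact: cvg_cst.
have H2 : {for y, continuous (fun _ : R => 2 : R)} by exact: cvg_cst.
exact: (continuousM H2 H).
Qed.

End SquaredPositivePart.

Section Profiles.
Context (R : realType).
Implicit Types e r u w y : R.

(** A [C^1] step from 0 on y <= 0 to 1 on y >= 1, with derivative 4 y (1 - y^2) in between; hence
    the crude bound 4 in [dcutoff_bound]. *)
Definition cutoff y : R := 1 - sqp (1 - sqp y).
Definition dcutoff y : R := posp (1 - sqp y) * posp y.

Lemma is_derive_comp_affine (F dF : R -> R) (k c : R) :
  (forall y : R, is_derive y (1 : R) F (dF y)) ->
  forall u : R, is_derive u (1 : R) (fun u => F (k * u + c)) (k * dF (k * u + c)).
Proof.
move=> HF u.
have Hg : is_derive u (1:R) (fun u => k * u + c) k.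
  by apply: is_derive_eq; rewrite addr0 [k%:A]mulr1.
have -> : k * dF (k * u + c) = dF (k * u + c) * k by rewrite mulrC.
by apply: (@is_derive1_comp _ F (fun u => k * u + c)).
Qed.

Lemma is_derive_cutoff y : is_derive y (1 : R) cutoff (dcutoff y).
Proof.
have H : is_derive y (1 : R) (fun y => 1 - sqp y) (- posp y).
  have := is_derive_sqp y => ?.
  by apply: is_derive_eq; rewrite add0r mul1r.
have H2 : is_derive y (1 : R) (fun y => sqp (1 - sqp y)) (posp (1 - sqp y) * - posp y).
  exact: (@is_derive1_comp _ (@sqp R) (fun y => 1 - sqp y) _ _ _ (is_derive_sqp _) H).
by apply: is_derive_eq; rewrite add0r mul1r mulrN opprK.
Qed.

Lemma cutoff_itv y : 0 <= cutoff y <= 1.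
Proof.
rewrite /cutoff /sqp; apply/andP; split; last first.
  by rewrite lerBlDr lerDl sqr_ge0.
rewrite subr_ge0 expr_le1 // ?le_max ?lexx ?orbT // ge_max ler01 andbT.
by rewrite lerBlDr lerDl sqr_ge0.
Qed.

Lemma cutoff_le0 y : y <= 0 -> cutoff y = 0.
Proof.
move=> y0; rewrite /cutoff /sqp (max_r y0) expr0n /= subr0 max_l //.
by rewrite expr1n subrr.
Qed.

Lemma cutoff_ge1 y : 1 <= y -> cutoff y = 1.
Proof.
move=> y1; rewrite /cutoff /sqp (max_l (x := y)) ?(le_trans _ y1) // max_r.
  by rewrite expr0n /= subr0.
by rewrite subr_le0 expr_ge1 // (le_trans _ y1).
Qed.

Lemma dcutoff_out y : y <= 0 \/ 1 <= y -> dcutoff y = 0.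
Proof.
rewrite /dcutoff /posp /sqp => -[y0|y1]; first by rewrite (max_r y0) !mulr0.
rewrite (max_l (x := y)) ?(le_trans _ y1) // max_r ?mulr0 ?mul0r //.
by rewrite subr_le0 expr_ge1 // (le_trans _ y1).
Qed.

Lemma dcutoff_bound y : 0 <= dcutoff y <= 4.
Proof.
have [y0|y0] := leP y 0; first by rewrite dcutoff_out; [rewrite lexx ler0n|left].
have [y1|y1] := leP 1 y; first by rewrite dcutoff_out; [rewrite lexx ler0n|right].
rewrite /dcutoff /posp /sqp (max_l (x := y)) ?ltW // max_l; last nra.
all: nra.
Qed.

Lemma continuous_dcutoff : continuous dcutoff.
Proof.
move=> y.
have Hs : {for y, continuous (@sqp R)}.
  by apply/differentiable_continuous/derivable1_diffP; have [] := is_derive_sqp y.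
have H1 : {for y, continuous (fun y => 1 - sqp y)}.
  by apply: continuousB Hs; exact: cvg_cst.
have H2 : {for y, continuous (fun y => posp (1 - sqp y))}.
  exact: (continuous_comp H1 (@continuous_posp R _)).
exact: (continuousM H2 (@continuous_posp R y)).
Qed.

(* A C^1 tent on [0, 2 r]: its derivative [dtent] is piecewise affine, equal to 1
   on [e, r - e] and to -1 on [r + e, 2 r - e]. *)
Definition tent e r u : R := (2 * e)^-1 * (sqp u - sqp (u - e) - sqp (u - r + e)
  + sqp (u - r - e) + sqp (u - 2 * r + e) - sqp (u - 2 * r)).
Definition dtent e r u : R := e^-1 * (Num.max u 0 - Num.max (u - e) 0
  - Num.max (u - r + e) 0 + Num.max (u - r - e) 0 + Num.max (u - 2 * r + e) 0
  - Num.max (u - 2 * r) 0).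

Lemma is_derive_tent e r u : e != 0 -> is_derive u (1 : R) (tent e r) (dtent e r u).
Proof.
move=> e0.
have shift c : is_derive u (1 : R) (fun u => sqp (u + c)) (posp (u + c)).
  have H := is_derive_comp_affine 1 c (@is_derive_sqp R) u.
  by move: H; rewrite !mul1r; under eq_fun do rewrite mul1r.
have shift2 c d : is_derive u (1 : R) (fun u => sqp (u + c + d)) (posp (u + c + d)).
  by have := shift (c + d); rewrite addrA; under eq_fun do rewrite addrA.
have D := is_deriveZ (2 * e)^-1 (is_deriveB (is_deriveD (is_deriveD (is_deriveB (is_deriveB
  (is_derive_sqp u) (shift (- e))) (shift2 (- r) e)) (shift2 (- r) (- e)))
  (shift2 (- (2 * r)) e)) (shift (- (2 * r)))).
have -> : dtent e r u = (2 * e)^-1 *: (posp u - posp (u - e) - posp (u - r + e)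
  + posp (u - r - e) + posp (u - 2 * r + e) - posp (u - 2 * r)).
  have H (a b c d f g : R) : e^-1 * (a - b - c + d + f - g) =
      (2 * e)^-1 * (2 * a - 2 * b - 2 * c + 2 * d + 2 * f - 2 * g) by field.
  exact: H.
exact: D.
Qed.

Lemma tent_bound e r u : 0 < e -> 2 * e <= r -> 0 <= tent e r u <= r.
Proof.
move=> e0 er; rewrite /tent mulrC ler_pdivlMr ?ler_pdivrMr; try lra.
rewrite /sqp mul0r.
have maxE (t : R) : Num.max t 0 = if t <= 0 then 0 else t by case: (leP t 0).
rewrite !maxE.
do ?(case: ifPn; rewrite -?ltNge => ?; try (exfalso; lra)).
all: apply/andP; split; nra.
Qed.

Lemma tent_out e r u : 0 < e -> 2 * e <= r -> u <= 0 \/ 2 * r <= u -> tent e r u = 0.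
Proof.
move=> e0 er H; rewrite /tent.
have maxE (t : R) : Num.max t 0 = if t <= 0 then 0 else t by case: (leP t 0).
apply/eqP; rewrite mulf_eq0; apply/orP; right; apply/eqP.
rewrite /sqp !maxE.
case: H => ?; do ?(case: ifPn; rewrite -?ltNge => ?; try (exfalso; lra)).
all: try ring.
all: have -> : u = 2 * r by lra.
all: ring.
Qed.

Lemma dtent_bound e r u : 0 < e -> 2 * e <= r -> `|dtent e r u| <= 1.
Proof.
move=> e0 er; rewrite /dtent ler_norml mulrC ler_pdivlMr ?ler_pdivrMr //.
have maxE (t : R) : Num.max t 0 = if t <= 0 then 0 else t by case: (leP t 0).
rewrite !maxE.
do ?(case: ifPn; rewrite -?ltNge => ?; try (exfalso; lra)).
all: lra.
Qed.

Lemma dtent_out e r u : 0 < e -> 2 * e <= r -> u <= 0 \/ 2 * r <= u -> dtent e r u = 0.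
Proof.
move=> e0 er H; rewrite /dtent.
apply/eqP; rewrite mulf_eq0; apply/orP; right; apply/eqP.
case: H => ?.
  by rewrite !max_r ?subrr ?addr0 //; lra.
by rewrite !max_l; lra.
Qed.

Lemma dtent_up e r u : 0 < e -> e <= u <= r - e -> dtent e r u = 1.
Proof.
move=> e0 /andP[ue ur]; rewrite /dtent.
rewrite (max_l (x := u)); last lra.
rewrite (max_l (x := u - e)); last lra.
rewrite (max_r (x := u - r + e)); last lra.
rewrite (max_r (x := u - r - e)); last lra.
rewrite (max_r (x := u - 2 * r + e)); last lra.
rewrite (max_r (x := u - 2 * r)); last lra.
by field; lra.
Qed.

Lemma dtent_down e r u : 0 < e -> 2 * e <= r -> r + e <= u <= 2 * r - e -> dtent e r u = -1.
Proof.
move=> e0 er /andP[ue ur]; rewrite /dtent.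
rewrite (max_l (x := u)); last lra.
rewrite (max_l (x := u - e)); last lra.
rewrite (max_l (x := u - r + e)); last lra.
rewrite (max_l (x := u - r - e)); last lra.
rewrite (max_r (x := u - 2 * r + e)); last lra.
rewrite (max_r (x := u - 2 * r)); last lra.
by field; lra.
Qed.

Lemma continuous_dtent e r : continuous (dtent e r).
Proof.
move=> u.
have maxg (g : R -> R) : {for u, continuous g} ->
    {for u, continuous (fun u => Num.max (g u) 0)}.
  by move=> cg; apply: (@continuous_max R^o R g (fun=> 0)) => //; exact: cvg_cst.
have shift0 : {for u, continuous (fun u => Num.max u 0)} by apply: maxg; exact: cvg_id.
have shift c : {for u, continuous (fun u => Num.max (u + c) 0)}.
  by apply: maxg; apply: cvgD; [exact: cvg_id|exact: cvg_cst].
have shift2 c d : {for u, continuous (fun u => Num.max (u + c + d) 0)}.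
  by apply: maxg; do 2 (apply: cvgD; last exact: cvg_cst); exact: cvg_id.
have H1 : {for u, continuous (fun _ : R => e^-1 : R)} by exact: cvg_cst.
exact: (continuousM H1 (continuousB (continuousD (continuousD (continuousB (continuousB
  shift0 (shift (- e))) (shift2 (- r) e)) (shift2 (- r) (- e)))
  (shift2 (- (2 * r)) e)) (shift (- (2 * r))))).
Qed.

Definition window e w u : R := cutoff (u / e) * cutoff ((w - u) / e).

Lemma window_bound e w u : 0 <= window e w u <= 1.
Proof.
have /andP[a0 a1] := cutoff_itv (u / e); have /andP[b0 b1] := cutoff_itv ((w - u) / e).
by rewrite mulr_ge0 //= mulr_ile1.
Qed.

Lemma window_out e w u : 0 < e -> u <= 0 \/ w <= u -> window e w u = 0.
Proof.
move=> e0 [u0|wu]; rewrite /window.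
  by rewrite cutoff_le0 ?mul0r // mulr_le0_ge0 // invr_ge0 ltW.
by rewrite [cutoff ((w - u) / e)]cutoff_le0 ?mulr0 // mulr_le0_ge0 ?subr_le0 // invr_ge0 ltW.
Qed.

Lemma window_in e w u : 0 < e -> e <= u <= w - e -> window e w u = 1.
Proof.
move=> e0 /andP[eu uw]; rewrite /window !cutoff_ge1 ?mulr1 // ler_pdivlMr // mul1r //.
lra.
Qed.

End Profiles.

(** * Test fields given by their components *)

Section Fields.
Context (R : realType) (N : nat).
Local Notation V := 'rV[R]_N.
Local Notation T := (leb_space R N).

Definition field_of (G : 'I_N -> V -> R) (x : V) : V := \row_i G i x.

Lemma differentiable_field_of G x : (forall i, differentiable (G i) x) ->
  differentiable (field_of G) x.
Proof.
move=> dG.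
have -> : field_of G = \sum_i (fun x : V => G i x *: (delta_mx ord0 i : V)).
  apply/funext => y; apply/rowP => j; rewrite mxE fct_sumE summxE (bigD1 j) //=.
  rewrite big1 => [|i ij]; first by rewrite !mxE !eqxx mulr1 addr0.
  by rewrite !mxE eqxx /= eq_sym (negPf ij) mulr0.
by apply: differentiable_sum => i; exact: differentiableZl.
Qed.

Lemma derive_field_of G v x : (forall i, differentiable (G i) x) ->
  'D_v (field_of G) x = field_of (fun i => 'D_v (G i)) x.
Proof.
move=> dG; rewrite derive_mx; last by apply: diff_derivable; exact: differentiable_field_of.
apply/matrixP => i j; rewrite ord1 !mxE; congr ('D_v _ x).
by apply/funext => y; rewrite mxE.
Qed.

Lemma continuous_row (f : V -> V) x : (forall i, {for x, continuous (fun y => f y ord0 i)}) ->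
  {for x, continuous f}.
Proof.
move=> cf A [P HP PA]; have H : nbhs x [set y | forall j, P ord0 j (f y ord0 j)].
  have FF : Filter (nbhs x) by exact: nbhs_filter.
  apply: (@filter_forall _ _ (fun j y => P ord0 j (f y ord0 j)) _ FF) => j.
  exact: (cf j _ (HP ord0 j)).
by apply: filterS H => y Hy; apply: PA => i j; rewrite ord1.
Qed.

Lemma admissible_field_of (K : set V) (G : 'I_N -> V -> R) :
  compact K -> (forall i, C1fun (G i)) -> (forall x, ~ K x -> forall i, G i x = 0) ->
  (forall x, \sum_i (G i x) ^+ 2 <= 1) -> admissible_field (field_of G).
Proof.
move=> cK CG G0 G1; split.
- by move=> x; apply: differentiable_field_of => i; exact: (CG i).1.
- move=> v x; apply: continuous_row => i.
  rewrite (_ : (fun y => _) = 'D_v (G i)); first exact: ((CG i).2 v x).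
  apply/funext => y; rewrite derive_field_of ?mxE // => j; exact: (CG j).1.
- apply: (subclosed_compact _ cK); first exact: closed_closure.
  rewrite closureE; apply: smallest_sub => [|x /= /eqP Gx].
    by apply: compact_closed => //; exact: norm_hausdorff.
  by apply: contrapT => Kx; apply: Gx; apply/rowP => i; rewrite !mxE G0.
- by move=> x; under eq_bigr do rewrite mxE.
Qed.

Lemma divergence_field_of (G : 'I_N -> V -> R) x : (forall i, C1fun (G i)) ->
  divergence (field_of G) x = \sum_i 'D_(delta_mx ord0 i) (G i) x.
Proof.
move=> CG; apply: eq_bigr => i _; rewrite derive_field_of ?mxE // => j.
exact: (CG j).1.
Qed.

(** With one nonzero component, the Euclidean constraint becomes a bound on |g| and the divergence a
    single partial derivative. *)
Lemma admissible_axis (K : set V) (c : 'I_N) (g : V -> R) :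
  compact K -> C1fun g -> (forall x, ~ K x -> g x = 0) -> (forall x, `|g x| <= 1) ->
  exists2 phi, admissible_field phi &
    forall x, divergence phi x = 'D_(delta_mx ord0 c) g x.
Proof.
move=> cK Cg g0 g1.
pose G i := if i == c then g else cst 0.
have CG i : C1fun (G i) by rewrite /G; case: ifP => _ //; exact: C1_cst.
exists (field_of G).
  apply: admissible_field_of cK CG _ _ => x.
    by move=> Kx i; rewrite /G; case: ifP => // _; exact: g0.
  rewrite (bigD1 c) //= big1 => [|i /negPf ic]; last by rewrite /G ic expr0n.
  by rewrite /G eqxx addr0 -real_normK ?num_real // expr_le1.
move=> x; rewrite divergence_field_of // (bigD1 c) //= big1 => [|i /negPf ic].
  by rewrite /G eqxx addr0.
by rewrite /G ic derive_cst.
Qed.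

Lemma compact_box (a b : V) : compact [set x : V | forall i, a ord0 i <= x ord0 i <= b ord0 i].
Proof.
have := @rV_compact _ N (fun i => `[a ord0 i, b ord0 i]%classic) (fun i => @segment_compact _ _ _).
by congr compact; apply/seteqP; split=> x xab i; have := xab i; rewrite /= in_itv.
Qed.

Lemma C1_affine i (k c : R) : C1fun (fun x : V => k * x ord0 i + c).
Proof. exact: (C1D (C1M (@C1_cst R N k) (@C1_coord R N i)) (@C1_cst R N c)). Qed.

Lemma C1_cutoff (f : V -> R) : C1fun f -> C1fun (fun x => cutoff (f x)).
Proof. exact: (C1_comp (@is_derive_cutoff R) (@continuous_dcutoff R)). Qed.

Lemma derive_affine i (k c : R) (x : V) :
  'D_(delta_mx ord0 i) (fun x : V => k * x ord0 i + c) x = k.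
Proof.
have H (u : R) : is_derive u (1:R) (fun u => k * u + c) k.
  by apply: is_derive_eq; rewrite addr0 [k%:A]mulr1.
transitivity (k * 'D_(delta_mx ord0 i) (fun x : V => x ord0 i) x).
  exact: (derive_comp1 _ H (@differentiable_coord _ _ _ x ord0 i)).
by rewrite derive_coord mxE !eqxx mulr1.
Qed.

End Fields.

(** * Bump functions adapted to the cells *)

Section Bump.
Context (R : realType) (N : nat) (i0 : 'I_N) (a0 : 'rV[R]_N) (L : R) (L0 : 0 < L).
Local Notation V := 'rV[R]_N.
Local Notation T := (leb_space R N).
Local Notation axis := (axis i0 L).
Local Notation halfwidth := (halfwidth i0 L).
Local Notation width := (width i0 L).
Local Notation cell := (cell i0 L).
Local Notation sibling := (sibling i0 L).

(** Independent of the coordinate along [axis l], so that the derivative of the bump in that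
    direction falls on the tent alone. *)
Definition side_window (e : R) l (a x : V) : R :=
  \prod_(i < N | i != axis l) window e (width l ord0 i) (x ord0 i - a ord0 i).

(* As e tends to 0, the derivative of the bump along the axis converges off the
   faces to the difference of the indicators of the two halves of the cell. *)
Definition cell_bump (e : R) l (a x : V) : R :=
  tent e (halfwidth l) (x ord0 (axis l) - a ord0 (axis l)) * side_window e l a x.

Definition cell_dbump (e : R) l (a x : V) : R :=
  dtent e (halfwidth l) (x ord0 (axis l) - a ord0 (axis l)) * side_window e l a x.

Lemma C1_side_window e l a : C1fun (side_window e l a).
Proof.
apply: C1_prod => i; apply: C1M; apply: C1_cutoff.
  have := @C1_affine R N i e^-1 (- (a ord0 i / e)); congr C1fun.
  by apply/funext => x; ring.
have := @C1_affine R N i (- e^-1) (width l ord0 i / e + a ord0 i / e); congr C1fun.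
by apply/funext => x; ring.
Qed.

Lemma C1_cell_bump e l a : e != 0 -> C1fun (cell_bump e l a).
Proof.
move=> e0; apply: C1M; last exact: C1_side_window.
apply: (C1_comp (fun u => @is_derive_tent R e (halfwidth l) u e0)); first exact: continuous_dtent.
exact: (C1D (@C1_coord R N (axis l)) (@C1_cst R N (- a ord0 (axis l)))).
Qed.

Lemma derive_cell_bump e l a x : e != 0 ->
  'D_(delta_mx ord0 (axis l)) (cell_bump e l a) x = cell_dbump e l a x.
Proof.
move=> e0; have Ct : C1fun (fun x : V => tent e (halfwidth l) (x ord0 (axis l) - a ord0 (axis l))).
  apply: (C1_comp (fun u => @is_derive_tent R e (halfwidth l) u e0)); first exact: continuous_dtent.
  exact: (C1D (@C1_coord R N (axis l)) (@C1_cst R N (- a ord0 (axis l)))).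
rewrite (deriveM_C1 _ _ Ct (C1_side_window e l a)).
rewrite [X in _ * X + _]derive_indep ?mulr0 ?add0r => [|y t]; last first.
  apply: eq_bigr => i /negPf ia; congr window.
  by rewrite !mxE eqxx /= ia mulr0 addr0.
rewrite /cell_dbump mulrC; congr (_ * _).
have Cx : C1fun (fun x : V => x ord0 (axis l) - a ord0 (axis l)).
  exact: (C1D (@C1_coord R N (axis l)) (@C1_cst R N (- a ord0 (axis l)))).
transitivity (dtent e (halfwidth l) (x ord0 (axis l) - a ord0 (axis l)) *
  'D_(delta_mx ord0 (axis l)) (fun x : V => x ord0 (axis l) - a ord0 (axis l)) x).
  exact: (derive_comp1 _ (fun u => @is_derive_tent R e (halfwidth l) u e0) (Cx.1 x)).
have := @derive_affine R N (axis l) 1 (- a ord0 (axis l)) x.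
under eq_fun do rewrite mul1r.
by move=> ->; rewrite mulr1.
Qed.

Lemma side_window_bound e l a x : 0 <= side_window e l a x <= 1.
Proof.
apply: (big_ind (fun y => 0 <= y <= 1)) => [|y z /andP[y0 y1] /andP[z0 z1]|i _].
- by rewrite ler01 lexx.
- by rewrite mulr_ge0 //= mulr_ile1.
- exact: window_bound.
Qed.

(** The indicator on the right carries the disjointness of the cells: by [sum_indic_corners] its sum
    over a level is at most 1, so the bound survives summation. *)
Lemma cell_bump_bound e l a x : 0 < e -> 2 * e <= halfwidth l ->
  0 <= cell_bump e l a x <= halfwidth l * \1_(cell l a) (x : T).
Proof.
move=> e0 eh; rewrite indicE; case: (boolP ((x : T) \in cell l a)) => xa.
  have /andP[w0 w1] := side_window_bound e l a x.
  have /andP[t0 t1] := tent_bound (x ord0 (axis l) - a ord0 (axis l)) e0 eh.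
  by rewrite mulr_ge0 //= ler_pM.
rewrite mulr0; suff -> : cell_bump e l a x = 0 by rewrite lexx.
have /existsNP[i /negP xi] : ~ cell l a x by move=> ?; case/negP: xa; rewrite inE.
have out : x ord0 i - a ord0 i <= 0 \/ width l ord0 i <= x ord0 i - a ord0 i.
  by move: xi; rewrite negb_and -ltNge -leNgt => /orP[]; [left|right]; lra.
have [ia|ia] := eqVneq i (axis l).
  by rewrite /cell_bump tent_out ?mul0r //; move: out; rewrite ia width_axis.
by rewrite /cell_bump /side_window (bigD1 i) //= window_out // mul0r mulr0.
Qed.

Lemma dbump_bound e l a x : 0 < e -> 2 * e <= halfwidth l -> `|cell_dbump e l a x| <= 1.
Proof.
move=> e0 eh; have /andP[w0 w1] := side_window_bound e l a x.
rewrite normrM -[leRHS]mulr1 ler_pM // ?dtent_bound //.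
by rewrite ger0_norm.
Qed.

End Bump.

(** * Cell averages and perimeter *)

Section Integration.
Context (R : realType) (N : nat) (i0 : 'I_N) (a0 : 'rV[R]_N) (L : R) (L0 : 0 < L).
Local Notation V := 'rV[R]_N.
Local Notation T := (leb_space R N).
Local Notation mu := (@leb R N).
Local Notation axis := (axis i0 L).
Local Notation halfwidth := (halfwidth i0 L).
Local Notation width := (width i0 L).
Local Notation cell := (cell i0 L).
Local Notation sibling := (sibling i0 L).
Local Notation corners := (corners i0 a0 L).
Local Notation spread := (spread i0 L).
Local Notation part := (part i0 L).
Local Notation K := (cell 0 a0).

(** A point is at sup-distance at most [spread l] from the corner of its cell. *)
Lemma near_cell (f : V -> R) (x : V) e : {for x, continuous f} -> 0 < e ->
  exists l0, forall l a, (l0 <= l)%N -> cell l a x -> `|f a - f x| < e.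
Proof.
move=> cf e0.
have /nbhs_ballP[d /= d0 Hd] : nbhs x [set y | `|f y - f x| < e].
  by move/cvgrPdist_lt: cf => /(_ e e0); apply: filterS => y /=; rewrite distrC.
have /cvgr0Pnorm_lt /(_ d d0) [l0 _ Hl0] := spread_cvg0 i0 L0.
exists l0 => l a ll0 ax; apply: Hd; split=> // i j; rewrite -ball_normE /= ord1.
have := ax j; have := width_le_spread i0 L0 l j; have := Hl0 l ll0.
rewrite /= ger0_norm ?spread_ge0 // => ? ? /andP[? ?].
by rewrite ltr_norml; lra.
Qed.

(** This links the topology of row vectors with Caratheodory measurability: on the cube, [f] is the
    pointwise limit of the step functions equal on each cell to the value of [f] at its corner. *)
Lemma measurable_fun_continuous (E : set T) (f : V -> R) : measurable E -> E `<=` K ->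
  continuous f -> measurable_fun E (f : T -> R).
Proof.
move=> mE EK cf.
apply: (measurable_fun_cvg (h := fun l (x : T) =>
    \sum_(a <- corners l) f a * \1_(cell l a) x)).
  move=> l; apply: measurable_sum => a; apply: measurable_funM.
    exact: measurable_cst.
  by apply: measurable_indic; exact: measurable_cell.
move=> x /EK Kx; apply/cvgrPdist_lt => e e0.
have [l0 Hl0] := near_cell (@cf x) (divr_gt0 e0 (ltr0n R 2)).
exists l0 => // l /= ll0.
have -> : f x = \sum_(a <- corners l) f x * \1_(cell l a) (x : T).
  by rewrite -mulr_sumr (sum_indic_corners i0 a0 L0) indicE mem_set // mulr1.
rewrite -sumrB; apply: (@le_lt_trans _ _ (e / 2)); last lra.
apply: (le_trans (ler_norm_sum _ _ _)).
have <- : \sum_(a <- corners l) (e / 2) * \1_(cell l a) (x : T) = e / 2.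
  by rewrite -mulr_sumr (sum_indic_corners i0 a0 L0) indicE mem_set // mulr1.
apply: ler_sum => a _; rewrite -mulrBl normrM (ger0_norm (x := \1_ _ _)) //.
rewrite indicE; case: (boolP (_ \in _)); rewrite ?mulr0 //= !mulr1 inE => xa.
by rewrite distrC ltW // (Hl0 l a).
Qed.

Lemma bounded_continuous (f : V -> R) : continuous f ->
  exists2 M, 0 <= M & forall x, K x -> `|f x| <= M.
Proof.
move=> cf; have cK := @compact_box R N a0 (a0 + width 0).
have /compact_bounded[M [Mr HM]] := continuous_compact (continuous_subspaceT cf) cK.
exists (`|M| + 1) => [|x Kx]; first by rewrite addr_ge0.
apply: (HM (`|M| + 1)); first by rewrite (le_lt_trans (ler_norm M)) // ltrDl.
by exists x => // i; have /andP[xa xb] := Kx i; rewrite [X in _ <= _ <= X]mxE xa ltW.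
Qed.

Lemma integrable_bounded (E : set T) (f : T -> R) M : measurable E -> E `<=` K ->
  measurable_fun E f -> (forall x, E x -> `|f x| <= M) -> mu.-integrable E (EFin \o f).
Proof.
move=> mE EK mf fM; apply: measurable_bounded_integrable => //.
  by rewrite -ge0_fin_numE // (leb_subcell_fin L0 mE EK).
exists M; split; first exact: num_real.
by move=> M' MM' x Ex; apply: (le_trans (fM x Ex)); exact: ltW.
Qed.

Lemma integrable_continuous (E : set T) (f : V -> R) : measurable E -> E `<=` K ->
  continuous f -> mu.-integrable E (EFin \o f).
Proof.
move=> mE EK cf; have [M _ HM] := bounded_continuous cf.
apply: (integrable_bounded mE EK (M := M)); first exact: measurable_fun_continuous.
by move=> x /EK; exact: HM.
Qed.

(** The slice lies in boxes of thickness [n.+1%:R^-1]. Needed because the derivatives of the bumps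
    are shown to converge off the faces of the cells only. *)
Lemma hyperplane_negligible i (t : R) : mu.-negligible [set x : T | K x /\ (x : V) ord0 i = t].
Proof.
pose B n : set T := box (setrow a0 i t) (setrow (a0 + width 0) i (t + n.+1%:R^-1)).
exists (\bigcap_n B n); split.
- by apply: bigcapT_measurable => n; exact: measurable_box.
- pose C := \prod_(j < N | j != i) Num.max ((a0 + width 0) ord0 j - a0 ord0 j) 0.
  have BC n : (leb (\bigcap_n B n) <= (n.+1%:R^-1 * C)%:E)%E.
    apply: (@le_trans _ _ (leb (B n))).
      apply: le_measure; rewrite ?inE; [|exact: measurable_box|exact: bigcap_inf].
      by apply: bigcapT_measurable => m; exact: measurable_box.
    by rewrite leb_box box_vol_setrow addrAC subrr add0r max_l.
  have C0 : 0 <= C by apply: prodr_ge0 => j _; rewrite le_max lexx orbT.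
  apply/eqP; rewrite eq_le measure_ge0 andbT; apply/lee_addgt0Pr => e e0.
  rewrite add0e; have [n nC] : exists n : nat, C / e < n%:R.
    by exists (Num.truncn (C / e)).+1; exact: truncnS_gt.
  apply: (le_trans (BC n)); rewrite lee_fin mulrC ler_pdivrMr //.
  move: nC; rewrite ltr_pdivrMr // => /ltW /le_trans; apply.
  by rewrite mulrC ler_pM2l // ler_nat.
- move=> x [Kx xt] n _ j; rewrite !setrowE; case: eqP => [->|_].
    by rewrite xt lexx ltrDl invr_gt0 ltr0n.
  by have := Kx j; rewrite [(a0 + _) _ _]mxE.
Qed.

End Integration.

(** * The field comparing the two halves of every cell *)

Section StepInequality.
Context (R : realType) (N : nat) (i0 : 'I_N) (a0 : 'rV[R]_N) (L : R) (L0 : 0 < L).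
Local Notation V := 'rV[R]_N.
Local Notation T := (leb_space R N).
Local Notation mu := (@leb R N).
Local Notation axis := (axis i0 L).
Local Notation halfwidth := (halfwidth i0 L).
Local Notation width := (width i0 L).
Local Notation cell := (cell i0 L).
Local Notation sibling := (sibling i0 L).
Local Notation corners := (corners i0 a0 L).
Local Notation part := (part i0 L).
Local Notation bump := (cell_bump i0 L).
Local Notation dbump := (cell_dbump i0 L).
Local Notation K := (cell 0 a0).

(** Division by [halfwidth l] normalizes the signed sum of the bumps to absolute value at most 1.
    The compact set required for the support is the closed cube, [K] being half-open. *)
Lemma step_field (s : V -> R) l e : (forall a, `|s a| <= 1) ->
  0 < e -> 2 * e <= halfwidth l ->
  exists2 phi, admissible_field phi & forall x, divergence phi x =
    (halfwidth l)^-1 * \sum_(a <- corners l) s a * dbump e l a x.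
Proof.
move=> s1 e0 eh; have h0 := halfwidth_gt0 i0 L0 l; have en : e != 0 by rewrite gt_eqF.
pose g (x : V) := (halfwidth l)^-1 * \sum_(a <- corners l) s a * bump e l a x.
have Cb a : C1fun (fun x => s a * bump e l a x).
  exact: (C1M (@C1_cst R N (s a)) (C1_cell_bump i0 L l a en)).
have Cg : C1fun g.
  exact: (C1M (@C1_cst R N (halfwidth l)^-1) (C1_sum (corners l) Cb)).
have g1 x : `|g x| <= \1_K (x : T).
  have hV : 0 <= (halfwidth l)^-1 by rewrite invr_ge0 ltW.
  rewrite /g normrM (ger0_norm hV) mulrC ler_pdivrMr //.
  rewrite -(sum_indic_corners i0 a0 L0 l) mulrC mulr_sumr.
  apply: (le_trans (ler_norm_sum _ _ _)); apply: ler_sum => a _.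
  have /andP[b0 b1] := cell_bump_bound a x e0 eh.
  by apply: le_trans b1; rewrite normrM (ger0_norm b0) ler_piMl.
have [phi Hphi dphi] : exists2 phi, admissible_field phi &
    forall x, divergence phi x = 'D_(delta_mx ord0 (axis l)) g x.
  apply: (admissible_axis (axis l) (@compact_box R N a0 (a0 + width 0)) Cg) => x.
    move=> Kx; apply/eqP; rewrite -normr_le0 (le_trans (g1 x)) // indicE memNset //.
    move=> xK; apply: Kx => i; have /andP[xa xb] := xK i.
    by rewrite [X in _ <= _ <= X]mxE xa ltW.
  by apply: (le_trans (g1 x)); rewrite indicE; case: (_ \in _).
exists phi => // x; rewrite dphi.
rewrite (deriveM_C1 _ _ (@C1_cst R N _) (C1_sum (corners l) Cb)) derive_cst mulr0 addr0.
rewrite (derive_sum_C1 _ _ _ Cb); congr (_ * _); apply: eq_bigr => a _.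
rewrite (deriveM_C1 _ _ (@C1_cst R N _) (C1_cell_bump i0 L l a en)) derive_cst mulr0 addr0.
by rewrite derive_cell_bump.
Qed.

Lemma continuous_dbump l a e : e != 0 -> continuous (dbump e l a).
Proof.
move=> e0; have <- : 'D_(delta_mx ord0 (axis l)) (bump e l a) = dbump e l a.
  by apply/funext => x; exact: derive_cell_bump.
exact: (C1_cell_bump i0 L l a e0).2.
Qed.

(** The factor 2 makes the requirement [2 * e <= halfwidth l] of the tent hold already at
    [n = 0]. *)
Definition shrink l n : R := halfwidth l / 2 / n.+1%:R.

Lemma shrink_gt0 l n : 0 < shrink l n.
Proof. by rewrite /shrink divr_gt0 // divr_gt0 // halfwidth_gt0. Qed.

Lemma shrink_le l n : 2 * shrink l n <= halfwidth l.
Proof.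
have h0 := halfwidth_gt0 i0 L0 l.
by rewrite /shrink mulrA mulrCA divff // mulr1 ler_pdivrMr // ler_peMr ?ler1n // ltW.
Qed.

Lemma near_shrink l (c : R) : 0 < c -> \forall n \near \oo, shrink l n <= c.
Proof.
move=> c0; have h0 := halfwidth_gt0 i0 L0 l.
exists (Num.truncn (halfwidth l / 2 / c)) => // n /= nc.
rewrite /shrink ler_pdivrMr // [c * _]mulrC -ler_pdivrMr //.
by apply: ltW; rewrite -truncn_le_nat.
Qed.

Definition off_faces l (a x : V) := (forall i, x ord0 i != a ord0 i /\
  x ord0 i != a ord0 i + width l ord0 i) /\
  x ord0 (axis l) != a ord0 (axis l) + halfwidth l.

(** The sequence is eventually constant: once [shrink l n] is below the distances from [x] to the
    faces and to the middle hyperplane, the windows equal 1 and the derivative of the tent is 1 or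
    -1. Outside the cell every term is 0. *)
Lemma dbump_cvg l a (x : V) : off_faces l a x ->
  dbump (shrink l n) l a x @[n --> \oo] -->
  (\1_(cell l.+1 a) (x : T) - \1_(cell l.+1 (sibling l a)) (x : T) : R).
Proof.
move=> [xf xm]; have h0 := halfwidth_gt0 i0 L0 l.
apply: cvg_near_cst.
have [/= xa|xa] := pselect (cell l a x); last first.
  apply: nearW => n.
  have /existsNP[i /negP xi] := xa.
  have xa' := xa; rewrite (cell_split i0 L0) in xa'.
  rewrite !indicE !memNset ?subrr //=; [|by move=> ?; apply: xa'; right|by move=> ?; apply: xa'; left].
  have out : x ord0 i - a ord0 i <= 0 \/ width l ord0 i <= x ord0 i - a ord0 i.
    by move: xi; rewrite negb_and -ltNge -leNgt => /orP[]; [left|right]; lra.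
  have [ia|ia] := eqVneq i (axis l).
    rewrite /cell_dbump dtent_out ?mul0r //; [exact: shrink_gt0|exact: shrink_le|].
    by move: out; rewrite ia width_axis.
  by rewrite /cell_dbump /side_window (bigD1 i) //= window_out ?mul0r ?mulr0 //; exact: shrink_gt0.
have sw : \forall n \near \oo, side_window i0 L (shrink l n) l a x = 1.
  have H i : \forall n \near \oo, window (shrink l n) (width l ord0 i) (x ord0 i - a ord0 i) = 1.
    have /andP[ax xb] := xa i; have [/eqP xi /eqP xi'] := xf i.
    have c1 : 0 < x ord0 i - a ord0 i by rewrite subr_gt0 lt_neqAle ax andbT eq_sym; apply/eqP.
    have c2 : 0 < a ord0 i + width l ord0 i - x ord0 i by rewrite subr_gt0.
    near=> n; apply: window_in; first exact: shrink_gt0.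
    have : shrink l n <= x ord0 i - a ord0 i by near: n; exact: near_shrink.
    have : shrink l n <= a ord0 i + width l ord0 i - x ord0 i by near: n; exact: near_shrink.
    by move=> ? ?; apply/andP; split => //; lra.
  have FF : Filter (\oo : set_system nat) by typeclasses eauto.
  apply: filterS (@filter_forall _ _ (fun i n => window (shrink l n) (width l ord0 i)
    (x ord0 i - a ord0 i) = 1) _ FF H) => n Hn.
  by rewrite /side_window big1.
have /andP[ax xb] := xa (axis l); have [/eqP xi _] := xf (axis l).
have c1 : 0 < x ord0 (axis l) - a ord0 (axis l) by rewrite subr_gt0 lt_neqAle ax andbT eq_sym; apply/eqP.
have c2 : 0 < a ord0 (axis l) + width l ord0 (axis l) - x ord0 (axis l) by rewrite subr_gt0.
rewrite width_axis in xb c2.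
rewrite !indicE (cell_left i0 L0) (cell_right i0 L0) in_setI in_setD mem_set //=.
have [xlt|xge] := ltP (x ord0 (axis l)) (a ord0 (axis l) + halfwidth l).
  rewrite mem_set //= subr0; near=> n.
  rewrite /cell_dbump (near sw n) // mulr1.
  apply: dtent_up; first exact: shrink_gt0.
  have : shrink l n <= x ord0 (axis l) - a ord0 (axis l) by near: n; exact: near_shrink.
  have : shrink l n <= a ord0 (axis l) + halfwidth l - x ord0 (axis l).
    by near: n; apply: near_shrink; rewrite subr_gt0.
  by move=> ? ?; apply/andP; split => //; lra.
rewrite memNset /=; last by rewrite /halfspace /= => xlt; move: xge; rewrite leNgt xlt.
rewrite sub0r; near=> n.
rewrite /cell_dbump (near sw n) // mulr1.
apply: dtent_down; [exact: shrink_gt0|exact: shrink_le|].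
have : shrink l n <= x ord0 (axis l) - (a ord0 (axis l) + halfwidth l).
  by near: n; apply: near_shrink; rewrite subr_gt0 lt_neqAle xge eq_sym xm.
have : shrink l n <= a ord0 (axis l) + 2 * halfwidth l - x ord0 (axis l).
  by near: n; exact: near_shrink.
by move=> ? ?; apply/andP; split => //; lra.
Unshelve. all: by end_near. Qed.

End StepInequality.

Section Poincare.
Context (R : realType) (N : nat) (i0 : 'I_N) (a0 : 'rV[R]_N) (L : R) (L0 : 0 < L).
Local Notation V := 'rV[R]_N.
Local Notation T := (leb_space R N).
Local Notation mu := (@leb R N).
Local Notation axis := (axis i0 L).
Local Notation halfwidth := (halfwidth i0 L).
Local Notation width := (width i0 L).
Local Notation cell := (cell i0 L).
Local Notation sibling := (sibling i0 L).
Local Notation corners := (corners i0 a0 L).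
Local Notation part := (part i0 L).
Local Notation dbump := (cell_dbump i0 L).
Local Notation shrink := (shrink i0 L).
Local Notation cellvol := (cellvol i0 L).
Local Notation spread := (spread i0 L).
Local Notation oscillation := (oscillation i0 a0 L).
Local Notation K := (cell 0 a0).

Lemma ae_off_faces l (E : set T) : E `<=` K ->
  {ae mu, forall x : T, E x -> forall a, a \in corners l -> off_faces i0 L l a x}.
Proof.
move=> EK; have FF : Filter (almost_everywhere mu) by exact: ae_filter_ringOfSetsType.
have H i t : {ae mu, forall x : T, K x -> (x : V) ord0 i != t}.
  apply: (negligibleS _ (hyperplane_negligible i0 a0 L i t)).
  move=> x /= /not_implyP[Kx /negP/negPn/eqP xt]; by split.
have Ha a : {ae mu, forall x : T, K x -> off_faces i0 L l a x}.
  have H1 : {ae mu, forall x : T, forall i : 'I_N, K x -> (x : V) ord0 i != a ord0 i}.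
    exact: (@filter_forall _ _ (fun i (x : T) => K x -> (x : V) ord0 i != a ord0 i) _ FF).
  have H2 : {ae mu, forall x : T, forall i : 'I_N, K x ->
      (x : V) ord0 i != a ord0 i + width l ord0 i}.
    exact: (@filter_forall _ _ (fun i (x : T) => K x ->
      (x : V) ord0 i != a ord0 i + width l ord0 i) _ FF).
  apply: filterS3 H1 H2 (H (axis l) (a ord0 (axis l) + halfwidth l)) => x x1 x2 x3 Kx.
  by split=> [i|]; [split; [exact: x1|exact: x2]|exact: x3].
elim: (corners l) => [|a s IH]; first by apply: filterE.
apply: filterS2 (Ha a) IH => x xa xs Ex b; rewrite inE => /orP[/eqP ->|bs].
  exact/xa/EK.
exact: xs.
Qed.

Lemma perimeter_ge (E : set T) phi : admissible_field phi ->
  (\int[mu]_(x in E) (divergence phi x)%:E <= perimeter E)%E.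
Proof. by move=> Hphi; apply: ereal_sup_ubound; exists phi. Qed.

Lemma integral_parts (E : set T) l (c : R) (s : V -> R) : measurable E -> E `<=` K ->
  (\int[mu]_(x in E) (c * \sum_(a <- corners l)
     s a * (\1_(cell l.+1 a) x - \1_(cell l.+1 (sibling l a)) x))%:E =
   (c * \sum_(a <- corners l) s a * (part E l.+1 a - part E l.+1 (sibling l a)))%:E)%E.
Proof.
move=> mE EK.
have mi a : measurable_fun E (\1_(cell l.+1 a) : T -> R).
  by apply: measurable_indic; exact: measurable_cell.
have ii a : mu.-integrable E (EFin \o (\1_(cell l.+1 a) : T -> R)).
  apply: (integrable_bounded L0 mE EK (M := 1)) => // x _.
  by rewrite indicE; case: (_ \in _); rewrite ?normr1 ?normr0.
have id a : mu.-integrable E (fun x => (s a)%:E *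
    ((\1_(cell l.+1 a) x)%:E - (\1_(cell l.+1 (sibling l a)) x)%:E))%E.
  apply: integrableZl => //; exact: (integrableB mE (ii a) (ii (sibling l a))).
under eq_integral.
  move=> x _; rewrite EFinM -sumEFin.
  under eq_bigr do rewrite EFinM EFinB.
  over.
rewrite integralZl //; last exact: integrable_sum.
rewrite integral_sum // EFinM -sumEFin; congr (_ * _)%E; apply: eq_bigr => a _.
rewrite integralZl //; last exact: (integrableB mE (ii a) (ii (sibling l a))).
rewrite integralB_EFin // EFinM EFinB; congr (_ * (_ - _))%E.
  by rewrite integral_indic //; [rewrite setIC partE|exact: measurable_cell].
by rewrite integral_indic //; [rewrite setIC partE|exact: measurable_cell].
Qed.

(* Test the perimeter with the signed sum of the bumps of all cells: their
   supports are disjoint, so the field stays bounded by [halfwidth l]. *)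
Lemma step_inequality (E : set T) (p : R) l : measurable E -> E `<=` K ->
  (perimeter E <= p%:E)%E ->
  \sum_(a <- corners l) `|part E l.+1 a - part E l.+1 (sibling l a)| <= halfwidth l * p.
Proof.
move=> mE EK Ep; have h0 := halfwidth_gt0 i0 L0 l.
pose s (a : V) := Num.sg (part E l.+1 a - part E l.+1 (sibling l a)).
have s1 a : `|s a| <= 1 by rewrite /s normr_sg; case: (_ != 0).
pose F n (x : T) := (halfwidth l)^-1 * \sum_(a <- corners l) s a * dbump (shrink l n) l a x.
pose G (x : T) := (halfwidth l)^-1 * \sum_(a <- corners l)
  s a * (\1_(cell l.+1 a) x - \1_(cell l.+1 (sibling l a)) x).
have Fp n : (\int[mu]_(x in E) (F n x)%:E <= p%:E)%E.
  have [phi Hphi dphi] := step_field a0 L0 s1 (shrink_gt0 i0 L0 l n) (shrink_le i0 L0 l n).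
  apply: le_trans Ep; apply: le_trans (perimeter_ge E Hphi).
  by rewrite le_eqVlt; apply/orP; left; apply/eqP; apply: eq_integral => x _; rewrite dphi.
have mF n : measurable_fun E (EFin \o F n).
  apply/measurable_EFinP; apply: measurable_funM; first exact: measurable_cst.
  apply: measurable_sum => a; apply: measurable_funM; first exact: measurable_cst.
  apply: (measurable_fun_continuous L0 mE EK); apply: continuous_dbump.
  by rewrite gt_eqF ?shrink_gt0.
have mG : measurable_fun E (EFin \o G).
  apply/measurable_EFinP; apply: measurable_funM; first exact: measurable_cst.
  apply: measurable_sum => a; apply: measurable_funM; first exact: measurable_cst.
  by apply: measurable_funB; apply: measurable_indic; exact: measurable_cell.
have FG : {ae mu, forall x, E x -> (EFin \o F n) x @[n --> \oo] --> (EFin \o G) x}.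
  apply: filterS (ae_off_faces l EK) => x xf Ex.
  apply: cvg_EFin; first by apply: nearW.
  rewrite /= /F /G; apply: cvgMr; rewrite big_seq.
  under eq_fun do rewrite big_seq.
  apply: cvg_big => [|a ain]; first exact: add_continuous.
  apply: cvgMr.
  by apply: dbump_cvg => //; exact: xf.
(* A dominating constant: each of the [size (corners l)] summands is at most 1 in absolute value. *)
pose M := (halfwidth l)^-1 * (size (corners l))%:R.
have bF : {ae mu, forall x n, E x -> (`|(EFin \o F n) x| <= M%:E)%E}.
  have hV : 0 <= (halfwidth l)^-1 by rewrite invr_ge0 ltW.
  apply: nearW => x n _; rewrite /= lee_fin /F normrM (ger0_norm hV).
  rewrite ler_wpM2l // (le_trans (ler_norm_sum _ _ _)) //.
  rewrite -sum1_size natr_sum; apply: ler_sum => a _.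
  rewrite normrM mulr_ile1 //; apply: dbump_bound; [exact: shrink_gt0|exact: shrink_le].
have iM : mu.-integrable E (fun=> M%:E).
  apply: (integrable_bounded L0 mE EK (f := fun=> M) (M := `|M|)) => //.
have [_ _ cv] := dominated_convergence mE mF mG FG iM bF.
have : (\int[mu]_(x in E) (G x)%:E <= p%:E)%E.
  rewrite -(cvg_lim _ cv) //; apply: lime_le; first by apply/cvg_ex; eexists; exact: cv.
  exact: nearW.
rewrite integral_parts // lee_fin mulrC ler_pdivrMr // [p * _]mulrC.
by congr (_ <= _); apply: eq_bigr => a _; rewrite /s -normrEsg.
Qed.

End Poincare.

(** * A Poincare inequality *)

Section Oscillation.
Context (R : realType) (N : nat) (i0 : 'I_N) (a0 : 'rV[R]_N) (L : R) (L0 : 0 < L).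
Local Notation V := 'rV[R]_N.
Local Notation T := (leb_space R N).
Local Notation mu := (@leb R N).
Local Notation width := (width i0 L).
Local Notation cell := (cell i0 L).
Local Notation corners := (corners i0 a0 L).
Local Notation part := (part i0 L).
Local Notation cellvol := (cellvol i0 L).
Local Notation spread := (spread i0 L).
Local Notation oscillation := (oscillation i0 a0 L).
Local Notation K := (cell 0 a0).

Lemma oscillation_tail (E : set T) (p : R) l k : measurable E -> E `<=` K ->
  (perimeter E <= p%:E)%E ->
  oscillation E l <= oscillation E (l + k) + (spread l - spread (l + k)) * p.
Proof.
move=> mE EK Ep; elim: k => [|k IH]; first by rewrite addn0 subrr mul0r addr0.
apply: (le_trans IH); rewrite addnS (spreadS i0 L).
have := oscillation_step i0 a0 L0 (l + k) mE; have := step_inequality L0 (l + k) mE EK Ep.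
lra.
Qed.

Definition symdiff (E F : set T) : set T := (E `\` F) `|` (F `\` E).

Lemma measurable_symdiff (E F : set T) : measurable E -> measurable F ->
  measurable (symdiff E F).
Proof. by move=> mE mF; apply: measurableU; exact: measurableD. Qed.

Lemma le_mass l a (E F : set T) : measurable E -> measurable F -> E `<=` F ->
  F `<=` cell l a -> mass E <= mass F.
Proof.
move=> mE mF EF Fc; rewrite -lee_fin (massE L0 mE (subset_trans EF Fc)) (massE L0 mF Fc).
by apply: le_measure; rewrite ?inE.
Qed.

Lemma le_part l a (E F : set T) : measurable E -> measurable F ->
  E `&` cell l a `<=` F -> part E l a <= part F l a.
Proof.
move=> mE mF EF; apply: (@le_mass l a) => //.
- by apply: measurableI => //; exact: measurable_cell.
- by apply: measurableI => //; exact: measurable_cell.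
- by move=> x Ex; split; [exact: EF|case: Ex].
Qed.

Lemma partU_le l a (E F G : set T) : measurable E -> measurable F -> measurable G ->
  E `&` cell l a `<=` F `|` G -> part E l a <= part F l a + part G l a.
Proof.
move=> mE mF mG EFG; rewrite -lee_fin EFinD !(partE i0 L0) //.
have mc := measurable_cell i0 L l a.
apply: (@le_trans _ _ (mu ((F `&` cell l a) `|` (G `&` cell l a)))).
  apply: le_measure; rewrite ?inE.
  - exact: measurableI.
  - by apply: measurableU; exact: measurableI.
  - by move=> x Ex; have [Fx|Gx] := EFG _ Ex; [left|right]; split => //; case: Ex.
by apply: measureU2; exact: measurableI.
Qed.

Lemma part_symdiff l a (E F : set T) : measurable E -> measurable F ->
  `|part E l a - part F l a| <= part (symdiff E F) l a.
Proof.
move=> mE mF; have mS := measurable_symdiff mE mF.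
have H1 : part E l a <= part F l a + part (symdiff E F) l a.
  by apply: partU_le => // x [Ex _]; have [Fx|Fx] := pselect (F x); [left|right; left].
have H2 : part F l a <= part E l a + part (symdiff E F) l a.
  by apply: partU_le => // x [Ex _]; have [Fx|Fx] := pselect (E x); [left|right; right].
by rewrite ler_norml; lra.
Qed.

Lemma part_setC l a (E : set T) : measurable E -> part (~` E) l a = cellvol l - part E l a.
Proof.
move=> mE; have mC := measurableC mE; have mc := measurable_cell i0 L l a.
suff : part (~` E) l a + part E l a = cellvol l by lra.
apply: EFin_inj; rewrite EFinD !(partE i0 L0) // -(leb_cell i0 L0 l a) -measureU.
- by rewrite -setIUl setUC setUv setTI.
- exact: measurableI.
- exact: measurableI.
- by rewrite setIACA setICl set0I.
Qed.

(** The function t (v - t) / v is 1-Lipschitz on [0, v], and on each cell the masses of [E] and [F]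
    differ by at most that of the symmetric difference. *)
Lemma oscillation_symdiff l (E F : set T) : measurable E -> measurable F ->
  oscillation E l <= oscillation F l + part (symdiff E F) 0 a0.
Proof.
move=> mE mF; rewrite -(sum_part i0 a0 L0 l (measurable_symdiff mE mF)).
rewrite -big_split /=; apply: ler_sum => a _.
have := part_symdiff l a mE mF; have v0 := cellvol_gt0 i0 L0 l.
have := part_le i0 L0 l a mE; have := part_le i0 L0 l a mF.
have := part_ge0 i0 L E l a; have := part_ge0 i0 L F l a.
move: (part E l a) (part F l a) (part (symdiff E F) l a) v0 => x y z v0 y0 x0 yv xv xyz.
rewrite -lerBlDl; apply: le_trans xyz.
have -> : x * (cellvol l - x) / cellvol l - y * (cellvol l - y) / cellvol l =
  (x - y) * ((cellvol l - x - y) / cellvol l) by field; lra.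
apply: (le_trans (ler_norm _)); rewrite normrM ler_piMr // normrM.
have hV : 0 <= (cellvol l)^-1 by rewrite invr_ge0 ltW.
rewrite (ger0_norm hV) ler_pdivrMr // mul1r.
by rewrite ler_norml; lra.
Qed.

(** On a cell of volume v with masses x, y and z of [E], [F] and their intersection, v - z <= (v -
    x) + (v - y) and z is at most x and y, so z (v - z) <= x (v - x) + y (v - y). *)
Lemma oscillation_setI l (E F : set T) : measurable E -> measurable F ->
  oscillation (E `&` F) l <= oscillation E l + oscillation F l.
Proof.
move=> mE mF; have mI := measurableI _ _ mE mF.
rewrite -big_split /=; apply: ler_sum => a _.
have v0 := cellvol_gt0 i0 L0 l.
have H1 : part (E `&` F) l a <= part E l a by apply: le_part => // x [[]].
have H2 : part (E `&` F) l a <= part F l a by apply: le_part => // x [[]].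
have H3 : cellvol l - part (E `&` F) l a <= (cellvol l - part E l a) + (cellvol l - part F l a).
  rewrite -!part_setC //; apply: partU_le; do ?exact: measurableC.
  by move=> x [EFx _]; rewrite -setCI.
have := part_ge0 i0 L (E `&` F) l a; have := part_le i0 L0 l a mE; have := part_le i0 L0 l a mF.
move: (part E l a) (part F l a) (part _ l a) v0 H1 H2 H3 => x y z v0 zx zy zv yv xv z0.
rewrite -mulrDl ler_pM2r ?invr_gt0 //; nra.
Qed.

Lemma oscillation_setC l (E : set T) : measurable E -> oscillation (~` E) l = oscillation E l.
Proof.
move=> mE; apply: eq_bigr => a _; rewrite part_setC //; congr (_ / _).
by rewrite opprB addrCA subrr addr0 mulrC.
Qed.

(** Cells entirely on one side of the hyperplane contribute 0. The others lie in a slab of thickness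
    [2 * spread l] and contribute at most their volume; the product is the area of a face of the
    cube. *)
Lemma oscillation_halfspace i c l : oscillation (halfspace i c) l <=
  2 * spread l * \prod_(j < N | j != i) Num.max ((a0 + width 0) ord0 j - a0 ord0 j) 0.
Proof.
have s0 := spread_ge0 i0 L0 l; have v0 := cellvol_gt0 i0 L0 l.
pose S : set T := halfspace i (c + spread l) `\` halfspace i (c - spread l).
have mS : measurable S by apply: measurableD; exact: measurable_halfspace.
have mH := @measurable_halfspace R N i c.
apply: (@le_trans _ _ (part S 0 a0)).
  rewrite -(sum_part i0 a0 L0 l mS); apply: ler_sum => a _.
  have wi := width_le_spread i0 L0 l i.
  have [ac|ac] := leP (a ord0 i + width l ord0 i) c.
    suff -> : part (halfspace i c) l a = cellvol l by rewrite subrr mulr0 mul0r part_ge0.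
    apply: EFin_inj; rewrite (partE i0 L0) // -(leb_cell i0 L0 l a); congr (mu _).
    apply: setIidr => x xa; have /andP[_ xi] := xa i; exact: lt_le_trans xi ac.
  have [ca|ca] := leP c (a ord0 i).
    suff -> : part (halfspace i c) l a = 0 by rewrite !mul0r part_ge0.
    apply: EFin_inj; rewrite (partE i0 L0) // (_ : _ `&` _ = set0) ?measure0 //.
    rewrite -subset0 => x [xc xa]; have /andP[xi _] := xa i.
    by have := le_lt_trans (le_trans ca xi) xc; rewrite ltxx.
  have -> : part S l a = cellvol l.
    apply: EFin_inj; rewrite (partE i0 L0) // -(leb_cell i0 L0 l a); congr (mu _).
    apply: setIidr => x xa; have /andP[x1 x2] := xa i.
    split; first by rewrite /halfspace /=; lra.
    by apply/negP; rewrite -leNgt; lra.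
  rewrite ler_pdivrMr //.
  have := part_le i0 L0 l a mH; have := part_ge0 i0 L (halfspace i c) l a; nra.
rewrite -lee_fin (partE i0 L0) //.
apply: (@le_trans _ _ (mu (box (setrow a0 i (c - spread l)) (setrow (a0 + width 0) i (c + spread l))))).
  apply: le_measure; rewrite ?inE; [|exact: measurable_box|].
    by apply: measurableI => //; exact: measurable_cell.
  move=> x [[/= x1 /negP x2] xK] j; rewrite !setrowE; case: eqP => [->|_].
    by rewrite leNgt x2 x1.
  by have := xK j; rewrite [(a0 + _) _ _]mxE.
rewrite leb_box box_vol_setrow lee_fin (_ : c + _ - (c - _) = 2 * spread l); last by ring.
by rewrite max_l ?lexx // mulr_ge0.
Qed.

(* The sets whose indicators are recovered in L^1 from the cell averages. *)
Definition resolved (E : set T) :=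
  measurable E /\ forall e, 0 < e -> exists l0, forall l, (l0 <= l)%N -> oscillation E l <= e.

Lemma resolved_halfspace i c : resolved (halfspace i c).
Proof.
split=> [|e e0]; first exact: measurable_halfspace.
set C := \prod_(j < N | j != i) Num.max ((a0 + width 0) ord0 j - a0 ord0 j) 0.
have C0 : 0 <= C by apply: prodr_ge0 => j _; rewrite le_max lexx orbT.
have d0 : 0 < e / (2 * (C + 1)) by rewrite divr_gt0 // mulr_gt0 // ltr_wpDl.
have /cvgr0Pnorm_le /(_ _ d0) [l0 _ Hl0] := spread_cvg0 i0 L0.
exists l0 => l /Hl0 /=; rewrite ger0_norm ?spread_ge0 // ler_pdivlMr ?mulr_gt0 ?ltr_wpDl // => Hl.
apply: (le_trans (oscillation_halfspace i c l)); rewrite -/C.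
have := spread_ge0 i0 L0 l; nra.
Qed.

Lemma resolved_setC E : resolved E -> resolved (~` E).
Proof.
move=> [mE HE]; split=> [|e /HE[l0 Hl0]]; first exact: measurableC.
by exists l0 => l /Hl0; rewrite oscillation_setC.
Qed.

Lemma resolved_setI E F : resolved E -> resolved F -> resolved (E `&` F).
Proof.
move=> [mE HE] [mF HF]; split=> [|e e0]; first exact: measurableI.
have e20 : 0 < e / 2 by rewrite divr_gt0.
have [l1 H1] := HE _ e20; have [l2 H2] := HF _ e20.
exists (maxn l1 l2) => l; rewrite geq_max => /andP[/H1 h1 /H2 h2].
by apply: (le_trans (oscillation_setI l mE mF)); lra.
Qed.

Lemma resolved_setU E F : resolved E -> resolved F -> resolved (E `|` F).
Proof.
move=> rE rF; rewrite -[E `|` F]setCK setCU.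
by apply/resolved_setC/resolved_setI; exact: resolved_setC.
Qed.

Lemma resolved_setT : resolved setT.
Proof.
split=> // e e0; exists 0%N => l _; rewrite /oscillation big1 ?ltW // => a _.
suff -> : part setT l a = cellvol l by rewrite subrr mulr0 mul0r.
by apply: EFin_inj; rewrite (partE i0 L0) // setTI leb_cell.
Qed.

Lemma resolved_box (a b : V) : resolved (box a b).
Proof.
have -> : (box a b : set T) = \big[setI/setT]_(i < N)
    (halfspace i (b ord0 i) `&` ~` halfspace i (a ord0 i)).
  rewrite -bigcap_seq; apply/seteqP; split=> [x abx i _|x abx i].
    by have /andP[ax xb] := abx i; split => //; apply/negP; rewrite -leNgt.
  by have [bx /negP] := abx i (mem_index_enum i); rewrite -leNgt => -> /=.
elim/big_ind: _ => [||i _]; [exact: resolved_setT|exact: resolved_setI|].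
by apply: resolved_setI; [|apply: resolved_setC]; exact: resolved_halfspace.
Qed.

End Oscillation.

(** * Vanishing oscillation and its consequences *)

Section Compactness.
Context (R : realType) (N : nat) (i0 : 'I_N) (a0 : 'rV[R]_N) (L : R) (L0 : 0 < L).
Local Notation V := 'rV[R]_N.
Local Notation T := (leb_space R N).
Local Notation mu := (@leb R N).
Local Notation width := (width i0 L).
Local Notation cell := (cell i0 L).
Local Notation corners := (corners i0 a0 L).
Local Notation part := (part i0 L).
Local Notation cellvol := (cellvol i0 L).
Local Notation spread := (spread i0 L).
Local Notation oscillation := (oscillation i0 a0 L).
Local Notation resolved := (resolved i0 a0 L).
Local Notation K := (cell 0 a0).

Lemma resolved_content (A : set T) : (box_content A < +oo)%E -> resolved A.
Proof.
have [->|/set0P A0] := eqVneq A set0.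
  by move=> _; rewrite -setCT; exact: (resolved_setC L0 (resolved_setT i0 a0 L0)).
rewrite /box_content asboolF; last by apply/eqP/set0P.
have [[[a b] /= <-] _|nA] := pselect (exists ab, box ab.1 ab.2 = A).
  exact: (resolved_box i0 a0 L0).
suff -> : [set ab | box ab.1 ab.2 = A] = set0 by rewrite image_set0 ereal_inf0 ltxx.
by rewrite -subset0 => ab abA; case: nA; exists ab.
Qed.

(** A nearly optimal cover of [E] exceeds it by at most e / 4, and a finite part [Un] of the cover
    misses at most e / 4 of [E]. So [Un] is within e / 2 of [E], and its own oscillation is
    eventually at most e / 4. *)
Lemma measurable_resolved (E : set T) : measurable E -> E `<=` K -> resolved E.
Proof.
move=> mE EK; split => // e e0; have e4 : 0 < e / 4 by rewrite divr_gt0.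
have Efin := leb_subcell_fin L0 mE EK.
have [_ [F [_ EF] <-] Fe] := lb_ereal_inf_adherent e4 Efin.
have rF k : resolved (F k).
  apply: resolved_content; rewrite ltey; apply/eqP => Fk.
  have Fn n : xpredT n -> box_content (F n) != -oo%E.
    by move=> _; rewrite -ltNye (lt_le_trans _ (box_content_ge0 _)).
  move: Fe; rewrite (eseries_pinfty Fn _ Fk) //.
  by rewrite ltNge leey.
pose U : set T := \bigcup_k F k.
have mF k : measurable (F k : set T) by case: (rF k).
have mU : measurable U by exact: bigcup_measurable.
have Ue : (mu U <= mu E + (e / 4)%:E)%E.
  by apply: le_trans (ltW Fe); apply: ereal_inf_lbound; exists F; last by []; split.
have UDE : (mu (U `\` E) <= (e / 4)%:E)%E.
  have Ufin : (mu U < +oo)%E.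
    by apply: (le_lt_trans Ue); rewrite -(fineK Efin) -EFinD ltry.
  rewrite measureD // (setIidr EF).
  by rewrite leeBlDl.
pose Un n : set T := \big[setU/set0]_(k < n) F k.
have rUn n : resolved (Un n).
  rewrite /Un; elim/big_ind: _ => [||k _]; [|exact: (resolved_setU L0)|exact: rF].
  by rewrite -setCT; exact: (resolved_setC L0 (resolved_setT i0 a0 L0)).
have mUn n : measurable (Un n) by case: (rUn n).
have cv : mu (E `&` Un n) @[n --> \oo] --> mu E.
  have EU : E = \bigcup_n (E `&` Un n).
    rewrite -setI_bigcupr; apply/esym/setIidl => x /EF[k _ Fx]; exists k.+1 => //.
    by rewrite /Un big_ord_recr; right.
  rewrite [X in _ --> mu X]EU.
  apply: nondecreasing_cvg_mu => //.
  - by move=> n; exact: measurableI.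
  - by rewrite -EU.
  - by move=> m n mn; apply/subsetPset; apply: setIS; exact: subset_bigsetU.
have [n En] : exists n, (mu E - (e / 4)%:E <= mu (E `&` Un n))%E.
  apply: contrapT => /forallNP nE.
  have : (mu E <= mu E - (e / 4)%:E)%E.
    rewrite -[leLHS](cvg_lim _ cv) //; apply: lime_le; first by apply/cvg_ex; eexists; exact: cv.
    by apply: nearW => n; have /negP := nE n; rewrite -ltNge => /ltW.
  by rewrite -(fineK Efin) -EFinB lee_fin; lra.
have EDU : (mu (E `\` Un n) <= (e / 4)%:E)%E.
  have mEU := measurableI _ _ mE (mUn n).
  have EUK : E `&` Un n `<=` K by move=> x [/EK].
  rewrite measureD //; last by rewrite -ge0_fin_numE.
  have -> : (mu E - mu (E `&` Un n) = (mass E - mass (E `&` Un n))%:E)%E.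
    by rewrite EFinB (massE L0 mE EK) (massE L0 mEU EUK).
  move: En; rewrite -(massE L0 mE EK) -(massE L0 mEU EUK) -EFinB !lee_fin.
  by rewrite lerBlDr => H; rewrite lerBlDl.
have [l0 Hl0] := (rUn n).2 _ e4; exists l0 => l /Hl0 Hl.
apply: (le_trans (oscillation_symdiff i0 a0 L0 l mE (mUn n))).
suff : part (symdiff E (Un n)) 0 a0 <= e / 4 + e / 4 by lra.
have mS := measurable_symdiff mE (mUn n).
rewrite -lee_fin (partE i0 L0) // EFinD.
apply: (@le_trans _ _ (mu (symdiff E (Un n)))).
  apply: le_measure; rewrite ?inE //.
  by apply: measurableI => //; exact: measurable_cell.
apply: (le_trans (measureU2 _ _ _)); try exact: measurableD.
apply: leeD => //; apply: le_trans UDE; apply: le_measure; rewrite ?inE; try exact: measurableD.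
apply: setSD => x; rewrite /Un -bigcup_mkord => -[k _ Fx]; by exists k.
Qed.

(** The zero field is admissible. *)
Lemma perimeter_ge0 (E : set T) : (0 <= perimeter E)%E.
Proof.
have n1 (x : V) : `|(cst 0 : V -> R) x| <= 1 by rewrite normr0.
have [phi Hphi dphi] := admissible_axis i0 (@compact0 V) (@C1_cst R N 0) (fun _ _ => erefl) n1.
apply: le_trans (perimeter_ge E Hphi).
by rewrite integral0_eq // => x _; rewrite dphi derive_cst.
Qed.

(** Telescope from [l] to [l + l0], a level where the oscillation of [E] is at most e. The number
    [l0] depends on [E], but the resulting bound does not. *)
Lemma poincare (E : set T) (p : R) l : measurable E -> E `<=` K ->
  (perimeter E <= p%:E)%E -> oscillation E l <= spread l * p.
Proof.
move=> mE EK Ep; have p0 : 0 <= p by rewrite -lee_fin (le_trans _ Ep) ?perimeter_ge0.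
apply/ler_addgt0Pr => e e0.
have [l0 /(_ (l + l0)%N (leq_addl _ _)) He] := (measurable_resolved mE EK).2 _ e0.
apply: (le_trans (oscillation_tail L0 l l0 mE EK Ep)).
have := spread_ge0 i0 L0 (l + l0); nra.
Qed.

Lemma part_self (E : set T) : E `<=` K -> part E 0 a0 = mass E.
Proof. by move=> EK; rewrite /part (setIidl EK). Qed.

(** A set of mass below half a cell fills less than half of every cell, so its oscillation is at
    least half its mass; the Poincare inequality makes it at most [spread l * lam] times the mass,
    which is less. *)
Lemma volume_lower_bound (E : set T) (lam : R) l : measurable E -> E `<=` K ->
  (perimeter E <= (lam * mass E)%:E)%E -> 0 < mass E -> spread l * lam < 1 / 2 ->
  cellvol l / 2 <= mass E.
Proof.
move=> mE EK Ep E0 Sl; rewrite leNgt; apply/negP => Ev.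
have := poincare l mE EK Ep; apply/negP; rewrite -ltNge.
apply: (@lt_le_trans _ _ (mass E / 2)); first by rewrite mulrA; nra.
rewrite -(part_self EK) -(sum_part i0 a0 L0 l mE) mulr_suml; apply: ler_sum => a _.
have v0 := cellvol_gt0 i0 L0 l.
have : part E l a <= mass E.
  apply: (@le_mass _ _ i0 L L0 0 a0) => //; first by apply: measurableI => //; exact: measurable_cell.
have := part_ge0 i0 L E l a; move: (part E l a) => x x0 xE.
rewrite ler_pdivlMr //; nra.
Qed.

(** The triangle inequality in L^1 through the cell averages of the two sets; twice the oscillation
    is the distance of an indicator to its averages. *)
Lemma mass_symdiff_le (E F : set T) l : measurable E -> measurable F -> E `<=` K -> F `<=` K ->
  mass (symdiff E F) <= 2 * oscillation E l + 2 * oscillation F l +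
    \sum_(a <- corners l) `|part E l a - part F l a|.
Proof.
move=> mE mF EK FK; have mS := measurable_symdiff mE mF.
have mc := measurable_cell i0 L.
rewrite -(part_self (E := symdiff E F)); last by move=> x [[/EK]|[/FK]].
rewrite -(sum_part i0 a0 L0 l mS) !mulr_sumr -!big_split /=; apply: ler_sum => a _.
have mEF := measurableD mE mF; have mFE := measurableD mF mE.
have mI := measurableI _ _ mE mF; have v0 := cellvol_gt0 i0 L0 l.
have addP (A B C : set T) : measurable A -> measurable B -> A `&` B = set0 -> C = A `|` B ->
    part C l a = part A l a + part B l a.
  move=> mA mB AB ->; apply: EFin_inj; rewrite EFinD !(partE i0 L0) //; last exact: measurableU.
  rewrite setIUl measureU //; [exact: measurableI|exact: measurableI|].
  by rewrite setIACA AB set0I.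
have EE := addP _ _ E mEF mI _ _; have FF := addP _ _ F mFE mI _ _.
have SS := addP _ _ (symdiff E F) mEF mFE _ erefl.
rewrite EE; last 2 first.
- by rewrite -subset0 => x [[_ nF] [_ Fx]].
- by rewrite setUC setUIDK.
rewrite FF; last 2 first.
- by rewrite setDE -subset0 => x [[_ nE] [Ex _]].
- by rewrite setUC (setIC E) setUIDK.
rewrite SS; last by rewrite -subset0 => x [[Ex _] [_ nE]].
have Uv : part (E `\` F) l a + part (F `\` E) l a + part (E `&` F) l a <= cellvol l.
  rewrite -SS; last by rewrite -subset0 => x [[Ex _] [_ nE]].
  rewrite -(addP _ _ _ mS mI _ erefl); first by apply: part_le => //; exact: measurableU.
  by rewrite -subset0 => x [[[_ nF]|[_ nE]] [Ex Fx]].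
have := part_ge0 i0 L (E `\` F) l a; have := part_ge0 i0 L (F `\` E) l a.
have := part_ge0 i0 L (E `&` F) l a; move: Uv v0.
move: (part (E `\` F) l a) (part (F `\` E) l a) (part (E `&` F) l a) (cellvol l).
move=> x y q v Uv v0 q0 y0 x0.
have xyv : (x - y) ^+ 2 <= `|x - y| * v.
  rewrite -real_normK ?num_real // expr2 ler_wpM2l //.
  by rewrite ler_norml; lra.
have -> : 2 * ((x + q) * (v - (x + q)) / v) + 2 * ((y + q) * (v - (y + q)) / v) + `|x + q - (y + q)| =
  (2 * ((x + q) * (v - (x + q))) + 2 * ((y + q) * (v - (y + q))) + `|x - y| * v) / v.
  by rewrite (_ : x + q - (y + q) = x - y); [field; lra|ring].
rewrite ler_pdivlMr //.
(* Once [xyv] has replaced |x - y| v by (x - y)^2, the right side minus the left is exactly this sum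
   of products of nonnegative factors. *)
have : 0 <= q * (2 * v - (x + q) - (y + q)) + (v - x - y - q) * ((x + q) + (y + q)).
  by rewrite addr_ge0 // mulr_ge0 //; lra.
move: (`|x - y|) xyv => z; nra.
Qed.

End Compactness.

(** * Compactness and lower semicontinuity *)

(** The image of [U] has a cluster point in the compact segment. If the complement of the set
    belonged to [U], the values of [f] would stay away from that point. *)
Lemma ultra_near_const (R : realType) (X : Type) (U : set_system X) (f : X -> R) (a b e : R) :
  UltraFilter U -> (forall x, a <= f x <= b) -> 0 < e ->
  exists y, U [set x | `|f x - y| < e].
Proof.
move=> UU fab e0; have FU : ProperFilter U by typeclasses eauto.
have /(_ (f @ U)) := @segment_compact R a b.
have UI : U (f @^-1` `[a, b]) by apply: filterE => x; rewrite /= in_itv; exact: fab.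
case=> //.
move=> y [_ yc]; exists y.
have [//|UC] := in_ultra_setVsetC [set x | `|f x - y| < e] UU.
have [|z [/= z1 z2]] := yc (f @` ~` [set x | `|f x - y| < e]) (ball y e) _ (nbhsx_ballx y e e0).
  apply: (@filterS X U _ (~` [set x | `|f x - y| < e])) UC => x Hx; by exists x.
case: z1 => x /= /negP nx fx; case/negP: nx; rewrite fx distrC.
by move: z2; rewrite -ball_normE.
Qed.

Section Limits.
Context (R : realType) (N : nat) (i0 : 'I_N) (a0 : 'rV[R]_N) (L : R) (L0 : 0 < L).
Local Notation V := 'rV[R]_N.
Local Notation T := (leb_space R N).
Local Notation mu := (@leb R N).
Local Notation cell := (cell i0 L).
Local Notation corners := (corners i0 a0 L).
Local Notation part := (part i0 L).
Local Notation cellvol := (cellvol i0 L).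
Local Notation spread := (spread i0 L).
Local Notation oscillation := (oscillation i0 a0 L).
Local Notation K := (cell 0 a0).

(** At a level fine enough for the Poincare inequality, a set is determined up to e / 2 by finitely
    many cell masses, and an ultrafilter makes all of these nearly constant at once. *)
Lemma ultra_cauchy (X : Type) (U : set_system X) (E : X -> set T) (p e : R) :
  UltraFilter U -> (forall x, measurable (E x)) -> (forall x, E x `<=` K) ->
  (forall x, (perimeter (E x) <= p%:E)%E) -> 0 < e ->
  exists2 A, U A & forall x y, A x -> A y -> mass (symdiff (E x) (E y)) <= e.
Proof.
move=> UU mE EK Ep e0; have FU : ProperFilter U by typeclasses eauto.
(* The oscillations of the two sets enter with factor 2, in all at most [4 * spread l * p], which is
   below e / 2. *)
have [l Sl] : exists l, spread l * (8 * (`|p| + 1)) < e.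
  have p0 : 0 < 8 * (`|p| + 1) by rewrite mulr_gt0 // ltr_wpDl.
  have [l Hl] := @spread_small R N i0 L L0 (e / (8 * (`|p| + 1))) (divr_gt0 e0 p0).
  by exists l; rewrite -ltr_pdivlMr.
(* Two masses within [eta] of the same value differ by at most [2 * eta], so the sum over the cells
   is at most e / 2. *)
pose eta := e / (4 * ((size (corners l))%:R + 1)).
have s0 : 0 < 4 * ((size (corners l))%:R + 1) :> R by rewrite mulr_gt0 // ltr_wpDl.
have eta0 : 0 < eta by rewrite divr_gt0.
have Uq (a : V) : exists y, U [set x | `|part (E x) l a - y| < eta].
  apply: (@ultra_near_const _ _ _ _ 0 (cellvol l)) => // x.
  by rewrite part_ge0 (part_le i0 L0).
have [y Hy] := choice Uq.
have UA : U [set x | forall a, a \in corners l -> `|part (E x) l a - y a| < eta].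
  elim: (corners l) => [|b s IH]; first by apply: filterE => x a.
  apply: filterS2 (Hy b) IH => x /= x1 x2 a; rewrite inE => /orP[/eqP ->//|]; exact: x2.
exists [set x | forall a, a \in corners l -> `|part (E x) l a - y a| < eta] => // x z Ax Az.
apply: (le_trans (mass_symdiff_le L0 l (mE x) (mE z) (@EK x) (@EK z))).
have ox := poincare L0 l (mE x) (@EK x) (Ep x).
have oz := poincare L0 l (mE z) (@EK z) (Ep z).
have S0 := spread_ge0 i0 L0 l.
have pp : spread l * p <= spread l * (`|p| + 1).
  by rewrite ler_wpM2l // (le_trans (ler_norm p)) // lerDl.
have : \sum_(a <- corners l) `|part (E x) l a - part (E z) l a| <= e / 2.
  apply: (@le_trans _ _ (\sum_(a <- corners l) (2 * eta))).
    rewrite big_seq [leRHS]big_seq; apply: ler_sum => a ain.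
    have := Ax a ain; have := Az a ain; rewrite !ltr_norml ler_norml; lra.
  have -> : \sum_(a <- corners l) 2 * eta = (size (corners l))%:R * (2 * eta).
    by rewrite big_const_seq count_predT iter_addr_0 -[LHS]mulr_natl.
  have : ((size (corners l))%:R + 1) * (4 * eta) = e by rewrite /eta; field; lra.
  have : 0 <= (size (corners l))%:R :> R by [].
  nra.
lra.
Qed.

(** A pointwise limit instead of an L^1 class: inclusion in [Om] and disjointness pass to it
    exactly, as [Ek] demands, and not merely up to null sets. *)
Definition set_liminf (S : nat -> set T) : set T := \bigcup_n \bigcap_(j in [set j | (n <= j)%N]) S j.

Lemma measurable_liminf (S : nat -> set T) : (forall n, measurable (S n)) ->
  measurable (set_liminf S).
Proof.
move=> mS; apply: bigcup_measurable => n _; apply: bigcap_measurable => //.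
by exists n => /=.
Qed.

(** A point whose membership never changes from index [n] on belongs to [S n] exactly when it
    belongs to the lower limit. *)
Lemma symdiff_liminf_sub (S : nat -> set T) n :
  symdiff (S n) (set_liminf S) `<=` \bigcup_j symdiff (S (n + j)%N) (S (n + j).+1).
Proof.
move=> x H; apply: contrapT => nx.
have step j : S (n + j)%N x <-> S (n + j).+1 x.
  have nj : ~ symdiff (S (n + j)%N) (S (n + j).+1) x by move=> ?; apply: nx; exists j.
  split=> ?; apply: contrapT => ?; apply: nj; [by left|by right].
have const j : S n x <-> S (n + j)%N x.
  elim: j => [|j IH]; first by rewrite addn0.
  by rewrite addnS; apply: iff_trans IH (step j).
case: H => [[Sx nl]|[[m _ Hm] nS]].
  by apply: nl; exists n => // j /= nj; rewrite -(subnKC nj); apply/const.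
apply: nS; apply/(const m); apply: Hm => /=; exact: leq_addl.
Qed.

Lemma mass_symdiff_liminf (S : nat -> set T) : (forall n, measurable (S n)) ->
  (forall n, S n `<=` K) ->
  (forall j, mass (symdiff (S j) (S j.+1)) <= 1 / (2 ^ j.+1)%:R) ->
  forall n, mass (symdiff (S n) (set_liminf S)) <= 1 / (2 ^ n)%:R.
Proof.
move=> mS SK HS n; have mL := measurable_liminf mS.
have LK : set_liminf S `<=` K.
  by move=> x [m _ Hm]; apply: (SK m); apply: Hm => /=.
have SLK : symdiff (S n) (set_liminf S) `<=` K by move=> x [[/SK]|[/LK]].
have mD j : measurable (symdiff (S j) (S j.+1)) by exact: measurable_symdiff.
rewrite -lee_fin (massE L0 (measurable_symdiff (mS n) mL) SLK).
have sub := measure_sigma_subadditive mu (fun j => mD (n + j)%N)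
  (measurable_symdiff (mS n) mL) (@symdiff_liminf_sub S n).
apply: (le_trans sub).
have e0 : (0 <= 1 / (2 ^ n)%:R :> R) by rewrite divr_ge0.
apply: le_trans (epsilon_trick0 xpredT e0).
apply: lee_nneseries => // j _.
have DK : symdiff (S (n + j)%N) (S (n + j).+1) `<=` K by move=> x [[/SK]|[/SK]].
rewrite /= -(massE L0 (mD _) DK) lee_fin (le_trans (HS _)) //.
by rewrite -addnS expnD natrM invfM mulrA.
Qed.

End Limits.

Section LowerSemicontinuity.
Context (R : realType) (N : nat) (i0 : 'I_N) (a0 : 'rV[R]_N) (L : R) (L0 : 0 < L).
Local Notation V := 'rV[R]_N.
Local Notation T := (leb_space R N).
Local Notation mu := (@leb R N).
Local Notation cell := (cell i0 L).
Local Notation cellvol := (cellvol i0 L).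
Local Notation spread := (spread i0 L).
Local Notation K := (cell 0 a0).

Lemma continuous_divergence phi : admissible_field phi ->
  continuous (divergence phi : V -> R).
Proof.
move=> [dphi cphi _ _] x; rewrite /divergence.
apply: (@cvg_big R 'I_N +%R 0 xpredT _ V (nbhs x) (index_enum _)
  (fun i x => ('D_(delta_mx ord0 i) phi x) ord0 i)
  (fun i => ('D_(delta_mx ord0 i) phi x) ord0 i)) => [|i _].
  exact: add_continuous.
exact: (@continuous_comp _ _ _ ('D_(delta_mx ord0 i) phi) (fun y : V => y ord0 i) x
  (cphi _ x) (@coord_continuous _ _ _ ord0 i _)).
Qed.

Lemma fine_integral (E : set T) (f : V -> R) : measurable E -> E `<=` K -> continuous f ->
  (\int[mu]_(x in E) (f x)%:E = (\int[mu]_(x in E) (f x))%:E)%E.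
Proof.
move=> mE EK cf; rewrite /Rintegral fineK //.
by apply: integrable_fin_num => //; exact: (integrable_continuous L0 mE EK cf).
Qed.

Lemma norm_Rintegral_le (E : set T) (f : V -> R) M : measurable E -> E `<=` K ->
  continuous f -> (forall x, K x -> `|f x| <= M) -> 0 <= M ->
  `|\int[mu]_(x in E) (f x)| <= M * mass E.
Proof.
move=> mE EK cf fM M0; have iE := integrable_continuous L0 mE EK cf.
apply: (le_trans (le_normr_Rintegral mE iE)).
rewrite -lee_fin EFinM (massE L0 mE EK).
rewrite /Rintegral fineK; last first.
  by apply: integrable_fin_num => //; apply: (integrable_norm iE).
apply: (@integral_le_bound _ T R mu E (EFin \o (f : T -> R)) M%:E) => //.
- by case/integrableP: iE.
- by apply: aeW => x Ex; rewrite lee_fin fM //; exact: EK.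
Qed.

Lemma Rintegral_split (E F : set T) (f : V -> R) : measurable E -> measurable F ->
  E `<=` K -> continuous f ->
  \int[mu]_(x in E) (f x) = \int[mu]_(x in E `&` F) (f x) + \int[mu]_(x in E `\` F) (f x).
Proof.
move=> mE mF EK cf; rewrite -{1}(setUIDK E F); apply: Rintegral_setU.
- exact: measurableI.
- exact: measurableD.
- by rewrite setUIDK; exact: (integrable_continuous L0 mE EK cf).
- by apply/eqP; rewrite setDE setIACA setICr setI0.
Qed.

Lemma Rintegral_symdiff (E F : set T) (f : V -> R) M : measurable E -> measurable F ->
  E `<=` K -> F `<=` K -> continuous f -> (forall x, K x -> `|f x| <= M) -> 0 <= M ->
  \int[mu]_(x in E) (f x) <= \int[mu]_(x in F) (f x) + 2 * M * mass (symdiff E F).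
Proof.
move=> mE mF EK FK cf fM M0.
rewrite (Rintegral_split mE mF EK cf) (Rintegral_split mF mE FK cf) (setIC F).
have mEF := measurableD mE mF; have mFE := measurableD mF mE.
have EFK : E `\` F `<=` K by move=> x [/EK].
have FEK : F `\` E `<=` K by move=> x [/FK].
have SK : symdiff E F `<=` K by move=> x [/EFK|/FEK].
have mS := measurable_symdiff mE mF.
have := norm_Rintegral_le mEF EFK cf fM M0; have := norm_Rintegral_le mFE FEK cf fM M0.
have : mass (E `\` F) <= mass (symdiff E F) by apply: (le_mass L0 mEF mS _ SK); left.
have : mass (F `\` E) <= mass (symdiff E F) by apply: (le_mass L0 mFE mS _ SK); right.
rewrite !ler_norml => h1 h2 /andP[h3 _] /andP[_ h4].
have := ler_wpM2l M0 h1; have := ler_wpM2l M0 h2; lra.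
Qed.

(** For a fixed field, the integral of the divergence is Lipschitz in the set for the L^1 distance,
    with a constant [2 * M] depending on the field. The tolerance [e / (2 * M + 1)] pays for this
    error and for the excess in the perimeter of [F]. *)
Lemma perimeter_lsc (E : set T) (b : R) : measurable E -> E `<=` K ->
  (forall e, 0 < e -> exists F, [/\ measurable F, F `<=` K, mass (symdiff E F) <= e &
     (perimeter F <= (b + e)%:E)%E]) ->
  (perimeter E <= b%:E)%E.
Proof.
move=> mE EK HF; apply: ge_ereal_sup => _ [phi Hphi <-].
have cf := continuous_divergence Hphi; have [M M0 fM] := bounded_continuous i0 a0 L cf.
rewrite fine_integral // lee_fin; apply/ler_addgt0Pr => e e0.
have M1 : 0 < 2 * M + 1 by rewrite ltr_wpDl // mulr_ge0.
have [F [mF FK EF Fb]] := HF (e / (2 * M + 1)) (divr_gt0 e0 M1).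
have : \int[mu]_(x in F) (divergence phi x) <= b + e / (2 * M + 1).
  by rewrite -lee_fin -fine_integral //; apply: le_trans Fb; exact: perimeter_ge.
have := Rintegral_symdiff mE mF EK FK cf fM M0.
have : 2 * M * mass (symdiff E F) <= 2 * M * (e / (2 * M + 1)) by rewrite ler_wpM2l // mulr_ge0.
have : (2 * M + 1) * (e / (2 * M + 1)) = e by rewrite mulrC divfK // gt_eqF.
lra.
Qed.

Lemma ratio_le (E : set T) (c : R) : 0 < mass E ->
  (Defs.ratio E <= c%:E)%E = (perimeter E <= (c * mass E)%:E)%E.
Proof.
move=> E0; rewrite /Defs.ratio -/(mass E).
by rewrite lee_pdivrMr // EFinM.
Qed.

Lemma mass_gt0 (E : set T) : measurable E -> E `<=` K -> (0 < mass E) = (0 < mu E)%E.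
Proof. by move=> mE EK; rewrite -lte_fin (massE L0 mE EK). Qed.

Lemma mass_le_symdiff (E F : set T) : measurable E -> measurable F ->
  E `<=` K -> F `<=` K -> `|mass E - mass F| <= mass (symdiff E F).
Proof.
move=> mE mF EK FK.
have SK : symdiff E F `<=` K by move=> x [[/EK]|[/FK]].
by rewrite -(part_self EK) -(part_self FK) -(part_self SK) (part_symdiff i0 L0).
Qed.

(** One ultrafilter finer than [\oo] serves all components and all tolerances, which replaces
    successive extractions and a diagonal argument. *)
Lemma fast_subsequence (k : nat) (E : nat -> 'I_k -> set T) (p : R) :
  (forall n i, measurable (E n i)) -> (forall n i, E n i `<=` K) ->
  (forall n i, (perimeter (E n i) <= p%:E)%E) ->
  exists m : nat -> nat, (forall n, (n <= m n)%N) /\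
    forall i n, mass (symdiff (E (m n) i) (E (m n.+1) i)) <= 1 / (2 ^ n.+1)%:R.
Proof.
move=> mE EK Ep.
have [U [UU Uoo]] := ultraFilterLemma (eventually_filter : ProperFilter (\oo : set_system nat)).
have FU : ProperFilter U by typeclasses eauto.
have HA (n : nat) : exists A, U A /\ forall i s t, A s -> A t ->
    mass (symdiff (E s i) (E t i)) <= 1 / (2 ^ n.+1)%:R.
  have e0 : 0 < 1 / (2 ^ n.+1)%:R :> R by rewrite divr_gt0 // ltr0n expn_gt0.
  have /choice[A HA] i : exists A, U A /\ forall s t, A s -> A t ->
      mass (symdiff (E s i) (E t i)) <= 1 / (2 ^ n.+1)%:R.
    have [A UA HA] := ultra_cauchy L0 UU (fun s => mE s i) (fun s => @EK s i) (fun s => Ep s i) e0.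
    by exists A.
  exists [set s | forall i, A i s]; split.
    by apply: (@filter_forall _ _ (fun i s => A i s) U _) => i; case: (HA i).
  by move=> i s t As At; have [_] := HA i; apply.
have [A {}HA] := choice HA.
(* Asking for all [A j] with [j <= n] puts both [m n] and [m n.+1] in [A n]. *)
pose B n := [set t | (n <= t)%N /\ forall j, (j <= n)%N -> A j t].
have UB n : U (B n).
  apply: filterI; first by apply: Uoo; exists n.
  elim: n => [|n IH].
    by apply: (@filterS _ U _ (A 0%N)) (HA 0%N).1 => t At j; rewrite leqn0 => /eqP ->.
  apply: (@filterS2 _ U _ (A n.+1) _ _) (HA n.+1).1 IH => t At IHt j.
  by rewrite leq_eqVlt => /orP[/eqP ->//|]; exact: IHt.
have /choice[m Hm] n : exists t, B n t by have [t] := filter_ex (UB n); exists t.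
exists m; split=> [n|i n]; first by case: (Hm n).
have [_] := HA n; apply; first by have [_] := Hm n; apply.
by have [_] := Hm n.+1; apply; exact: leqnSn.
Qed.

(** The closedness of the set of dominating vectors, in sequential form. *)
Lemma tuple_compactness (Om : set T) (k : nat) (E : nat -> 'I_k -> set T) (rho : 'I_k -> R) :
  Om `<=` K -> (forall n, Ek Om (E n)) ->
  (forall n i, (Defs.ratio (E n i) <= (rho i + n.+1%:R^-1)%:E)%E) ->
  exists2 F : 'I_k -> set T, Ek Om F & forall i, (Defs.ratio (F i) <= (rho i)%:E)%E.
Proof.
move=> OK EE Erho.
have mE n i : measurable (E n i) by case: (EE n) => /(_ i)[].
have EO n i : E n i `<=` Om by case: (EE n) => /(_ i)[].
have EK n i : E n i `<=` K := subset_trans (@EO n i) OK.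
have E0 n i : 0 < mass (E n i).
  by rewrite (mass_gt0 (mE n i) (@EK n i)); case: (EE n) => /(_ i)[].
pose v := cellvol 0; have v0 : 0 < v := cellvol_gt0 i0 L0 0.
have Ev n i : mass (E n i) <= v by rewrite -(part_self (@EK n i)) (part_le i0 L0).
(* A common bound for all ratios of all the tuples; it bounds the perimeters from above and, through
   [volume_lower_bound], the volumes from below. *)
pose lam := \sum_i `|rho i| + 1.
have lam0 : 0 < lam by rewrite ltr_wpDl // sumr_ge0.
have rlam i : rho i + 1 <= lam.
  rewrite lerD2r (le_trans (ler_norm _)) // (bigD1 i) //= lerDl; exact: sumr_ge0.
have n1 n : n.+1%:R^-1 <= 1 :> R by rewrite invf_le1 // ler1n.
have Elam n i : (perimeter (E n i) <= (lam * mass (E n i))%:E)%E.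
  rewrite -ratio_le //; apply: (le_trans (Erho n i)); rewrite lee_fin.
  by apply: le_trans (rlam i); rewrite lerD2l.
have Ep n i : (perimeter (E n i) <= (lam * v)%:E)%E.
  by apply: (le_trans (Elam n i)); rewrite lee_fin ler_wpM2l // ltW.
have [l Sl] : exists l, spread l * lam < 1 / 2.
  have [l Hl] := @spread_small R N i0 L L0 (1 / 2 / lam) (divr_gt0 (divr_gt0 ltr01 (ltr0n R 2)) lam0).
  by exists l; rewrite -ltr_pdivlMr.
have El n i : cellvol l / 2 <= mass (E n i).
  exact: (volume_lower_bound L0 (mE n i) (@EK n i) (Elam n i) (E0 n i) Sl).
have [m [mn Hm]] := fast_subsequence mE EK Ep.
pose F i := set_liminf (fun n => E (m n) i).
have mF i : measurable (F i) by apply: measurable_liminf.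
have FO i : F i `<=` Om by move=> x [n _ Hn]; apply: (@EO (m n) i); exact: (Hn n (leqnn n)).
have FK i : F i `<=` K := subset_trans (@FO i) OK.
have EF i n : mass (symdiff (E (m n) i) (F i)) <= 1 / (2 ^ n)%:R.
  exact: (mass_symdiff_liminf L0 (fun n => mE (m n) i) (fun n => @EK (m n) i) (Hm i)).
have small (e : R) : 0 < e -> exists n0, forall n, (n0 <= n)%N -> 1 / (2 ^ n)%:R <= e /\ n.+1%:R^-1 <= e.
  move=> e0; exists (Num.truncn e^-1) => n; rewrite truncn_le_nat => en.
  have H : n.+1%:R^-1 <= e by rewrite -[e]invrK lef_pV2 ?posrE ?invr_gt0 // ltW.
  split=> //; apply: le_trans H.
  by rewrite mul1r lef_pV2 ?posrE ?ltr0n ?expn_gt0 // ler_nat ltn_expl.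
have F0 i : 0 < mass (F i).
  have c0 : 0 < cellvol l / 4 by rewrite divr_gt0 // cellvol_gt0.
  have [n /(_ n (leqnn n))[Hn _]] := small _ c0.
  have := mass_le_symdiff (mE (m n) i) (mF i) (@EK _ _) (@FK i).
  have := El (m n) i; have := EF i n; rewrite ler_norml; lra.
exists F.
  split=> [i|i j ij].
    by split => //; rewrite -(mass_gt0 (mF i) (@FK i)).
  rewrite -subset0 => x [[p _ Hp] [q _ Hq]].
  have [_ /(_ i j ij)] := EE (m (maxn p q)); rewrite -subset0; apply; split.
    by apply: Hp; exact: leq_maxl.
  by apply: Hq; exact: leq_maxr.
move=> i; rewrite ratio_le //; apply: perimeter_lsc => // e e0.
(* The perimeter of an approximating set exceeds [rho i * mass (F i)] by at most [|rho i| * d], from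
   the change of volume, plus [d * v], from the slack in the ratio. The summand 1 gives d <= e. *)
pose d := e / (1 + `|rho i| + v).
have D0 : 0 < 1 + `|rho i| + v by rewrite ltr_pwDr // ltr_wpDr.
have d0 : 0 < d by rewrite divr_gt0.
have de : d * (1 + `|rho i| + v) = e by rewrite divfK // gt_eqF.
have [n /(_ n (leqnn n))[Hn _]] := small _ d0.
have [n2 /(_ (m (maxn n n2)))] := small _ d0.
set n3 := maxn n n2; move=> /(_ (leq_trans (leq_maxr _ _) (mn _)))[_ Hn3].
have Hs : mass (symdiff (F i) (E (m n3) i)) <= d.
  rewrite /symdiff setUC -/(symdiff _ _); apply: (le_trans (EF i n3)).
  apply: le_trans Hn; rewrite ler_wpM2l // lef_pV2 ?posrE ?ltr0n ?expn_gt0 //.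
  by rewrite ler_nat leq_exp2l // leq_maxl.
exists (E (m n3) i); split => //.
  by apply: (le_trans Hs); rewrite -de ler_peMr // ?ltW //; have := normr_ge0 (rho i); lra.
have := Erho (m n3) i; rewrite ratio_le // => /le_trans; apply; rewrite lee_fin.
have := mass_le_symdiff (mF i) (mE (m n3) i) (@FK i) (@EK _ _).
move=> /le_trans /(_ Hs); have := Ev (m n3) i; have := E0 (m n3) i.
move: (mass (F i)) (mass (E (m n3) i)) Hn3 => a b; move: (m n3).+1%:R^-1 => t td b0 bv ab.
have : rho i * (b - a) <= `|rho i| * d.
  by rewrite (le_trans (ler_norm _)) // normrM ler_wpM2l // distrC.
have : t * b <= d * v.
  by apply: (@le_trans _ _ (d * b)); [rewrite ler_wpM2r // ltW|rewrite ler_wpM2l // ltW].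
move: de; rewrite !mulrDr; lra.
Qed.

End LowerSemicontinuity.

(** * Cutting sets of finite perimeter *)

Section Cutting.
Context (R : realType) (N : nat) (i0 : 'I_N) (a0 : 'rV[R]_N) (L : R) (L0 : 0 < L).
Local Notation V := 'rV[R]_N.
Local Notation T := (leb_space R N).
Local Notation mu := (@leb R N).
Local Notation cell := (cell i0 L).
Local Notation width := (width i0 L).
Local Notation corners := (corners i0 a0 L).
Local Notation part := (part i0 L).
Local Notation cellvol := (cellvol i0 L).
Local Notation K := (cell 0 a0).

Lemma derive_component (phi : V -> V) v x j : differentiable phi x ->
  'D_v (fun y => phi y ord0 j) x = ('D_v phi x) ord0 j.
Proof.
by move=> dphi; rewrite derive_mx ?mxE //; exact: diff_derivable.
Qed.

Lemma C1_component phi j : admissible_field phi -> C1fun (fun x : V => phi x ord0 j).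
Proof.
move=> [dphi cphi _ _]; split=> [x|v x].
  exact: (differentiable_comp (dphi x) (differentiable_coord _ _ _)).
have -> : 'D_v (fun y => phi y ord0 j) = (fun x => ('D_v phi x) ord0 j).
  by apply/funext => y; exact: derive_component.
exact: (@continuous_comp _ _ _ ('D_v phi) (fun y : V => y ord0 j) x
  (cphi _ x) (@coord_continuous _ _ _ ord0 j _)).
Qed.

Lemma admissible_mul (h : V -> R) phi : C1fun h -> (forall x, `|h x| <= 1) ->
  admissible_field phi -> exists2 psi, admissible_field psi & forall x,
    divergence psi x = h x * divergence phi x +
      \sum_i phi x ord0 i * 'D_(delta_mx ord0 i) h x.
Proof.
move=> Ch h1 Hphi; have [dphi cphi cK phi1] := Hphi.
have CG j : C1fun (fun x => h x * phi x ord0 j) by exact: (C1M Ch (C1_component j Hphi)).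
exists (field_of (fun j x => h x * phi x ord0 j)).
  apply: (admissible_field_of cK CG) => x.
    move=> nK i; suff -> : phi x = 0 by rewrite mxE mulr0.
    apply/eqP/negPn/negP => px; apply: nK; exact: subset_closure.
  under eq_bigr do rewrite exprMn.
  rewrite -mulr_sumr mulr_ile1 ?sqr_ge0 ?phi1 //.
    by apply: sumr_ge0 => i _; exact: sqr_ge0.
  by rewrite -real_normK ?num_real // expr_le1.
move=> x; rewrite divergence_field_of // /divergence mulr_sumr -big_split /=.
apply: eq_bigr => i _; rewrite (deriveM_C1 _ _ Ch (C1_component i Hphi)).
by rewrite derive_component.
Qed.

Definition finite_perimeter (E : set T) := exists p : R, (perimeter E <= p%:E)%E.

(** The integral over the difference is that over [E] minus that over the intersection, and the
    opposite of an admissible field is admissible. *)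
Lemma finite_perimeter_setD (E F : set T) : measurable E -> measurable F -> E `<=` K ->
  finite_perimeter E -> finite_perimeter (E `&` F) -> finite_perimeter (E `\` F).
Proof.
move=> mE mF EK [p Ep] [q Eq]; exists (p + q).
apply: ge_ereal_sup => _ [phi Hphi <-]; have cf := continuous_divergence Hphi.
have EFK : E `\` F `<=` K by move=> x [/EK].
have IFK : E `&` F `<=` K by move=> x [/EK].
have mD := measurableD mE mF; have mI := measurableI _ _ mE mF.
rewrite (fine_integral L0 mD EFK cf) lee_fin.
have : \int[mu]_(x in E) (divergence phi x) <= p.
  by rewrite -lee_fin -(fine_integral L0 mE EK cf); apply: le_trans Ep; exact: perimeter_ge.
rewrite (Rintegral_split L0 mE mF EK cf).
have n1 (x : V) : `|(cst (-1) : V -> R) x| <= 1 by rewrite /= normrN normr1.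
have [psi Hpsi dpsi] := admissible_mul (@C1_cst R N (-1)) n1 Hphi.
set J := (X in X + _); have : - J <= q.
  rewrite -(lee_fin (- J) q) EFinN /J -(fine_integral L0 mI IFK cf).
  apply: le_trans Eq; apply: le_trans (perimeter_ge _ Hpsi).
  rewrite le_eqVlt; apply/orP; left; apply/eqP.
  transitivity (\int[mu]_(x in E `&` F) ((-1)%:E * (divergence phi x)%:E))%E.
    by rewrite (integralZl mI (integrable_continuous L0 mI IFK cf)) EFinN mulN1e.
  apply: eq_integral => x _; rewrite dpsi big1 => [|i _]; last by rewrite derive_cst mulr0.
  by rewrite addr0 EFinM.
lra.
Qed.

(** The cutoff of (c - x_i) / e, a smoothed indicator of [halfspace i c], written in the form that
    [C1_affine] and [derive_affine] expect. *)
Definition ramp (i : 'I_N) (c e : R) (x : V) : R := cutoff (- e^-1 * x ord0 i + c / e).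

Lemma ramp_bound i c e x : 0 <= ramp i c e x <= 1. Proof. exact: cutoff_itv. Qed.

Lemma C1_ramp i c e : C1fun (ramp i c e).
Proof. by apply: C1_cutoff; exact: C1_affine. Qed.

Lemma derive_ramp i c e j x : 'D_(delta_mx ord0 j) (ramp i c e) x =
  if j == i then - e^-1 * dcutoff (- e^-1 * x ord0 i + c / e) else 0.
Proof.
case: eqP => [->|/eqP ji].
  rewrite (derive_comp1 (delta_mx ord0 i) (@is_derive_cutoff R)
    ((C1_affine i (- e^-1) (c / e)).1 x)).
  by rewrite derive_affine mulrC.
apply: derive_indep => y t; rewrite /ramp !mxE eqxx /=.
by rewrite eq_sym (negPf ji) mulr0 addr0.
Qed.

Lemma ramp_argument i (c e : R) (x : V) : - e^-1 * x ord0 i + c / e = (c - x ord0 i) / e.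
Proof. by rewrite mulrBl mulNr addrC [_^-1 * _]mulrC. Qed.

Lemma ramp_cvg i c (x : V) : ramp i c n.+1%:R^-1 x @[n --> \oo] --> (\1_(halfspace i c) (x : T) : R).
Proof.
apply: cvg_near_cst; rewrite indicE; have [xc|cx] := ltP (x ord0 i) c.
  rewrite mem_set //; have xc0 : 0 < c - x ord0 i by rewrite subr_gt0.
  exists (Num.truncn (c - x ord0 i)^-1) => // n /=; rewrite truncn_le_nat => Hn.
  rewrite /ramp ramp_argument cutoff_ge1 // invrK mulrC -ler_pdivrMr //.
  by rewrite mul1r ltW.
rewrite memNset; last by rewrite /halfspace /= ltNge cx.
apply: nearW => n; rewrite /ramp ramp_argument cutoff_le0 // invrK.
by rewrite mulr_le0_ge0 // subr_le0.
Qed.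

(** Multiply the field by a ramp of width e. The product is admissible, and its divergence differs
    from the ramp times the divergence by a term at most 4 / e, supported in a slab of volume at
    most [e * C] in the cube, where [C] is the area of a face. The error [4 * C] does not depend on
    e, so the bound passes to the limit by dominated convergence. *)
Lemma finite_perimeter_halfspace (E : set T) i c : measurable E -> E `<=` K ->
  finite_perimeter E -> finite_perimeter (E `&` halfspace i c).
Proof.
move=> mE EK [p Ep].
set C := \prod_(j < N | j != i) Num.max ((a0 + width 0) ord0 j - a0 ord0 j) 0.
have C0 : 0 <= C by apply: prodr_ge0 => j _; rewrite le_max lexx orbT.
exists (p + 4 * C); apply: ge_ereal_sup => _ [phi Hphi <-].
have cf := continuous_divergence Hphi.
have [M M0 fM] := bounded_continuous i0 a0 L cf.
have mH := @measurable_halfspace R N i c; have mEH := measurableI _ _ mE mH.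
have EHK : E `&` halfspace i c `<=` K by move=> x [/EK].
pose F n (x : T) := ramp i c n.+1%:R^-1 x * divergence phi x.
have cF n : continuous (F n : V -> R).
  move=> x; exact: (continuousM (C1_continuous (C1_ramp i c n.+1%:R^-1)) (cf x)).
have iF n := integrable_continuous L0 mE EK (cF n).
have Fp n : (\int[mu]_(x in E) (F n x)%:E <= (p + 4 * C)%:E)%E.
  pose e : R := n.+1%:R^-1; have e0 : 0 < e by rewrite invr_gt0.
  have r1 (x : V) : `|ramp i c e x| <= 1.
    by have /andP[? ?] := ramp_bound i c e x; rewrite ger0_norm.
  have [psi Hpsi dpsi] := admissible_mul (C1_ramp i c e) r1 Hphi.
  pose S : set T := halfspace i c `\` halfspace i (c - e).
  have mS : measurable S by apply: measurableD => //; exact: measurable_halfspace.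
  have mES := measurableI _ _ mE mS; have ESK : E `&` S `<=` K by move=> x [/EK].
  have SC : mass (E `&` S) <= e * C.
    rewrite -lee_fin (massE L0 mES ESK).
    apply: (@le_trans _ _ (mu (box (setrow a0 i (c - e)) (setrow (a0 + width 0) i c)))).
      apply: le_measure; rewrite ?inE //; first exact: measurable_box.
      move=> x [/EK xK [/= x1 /negP x2]] j; rewrite !setrowE; case: eqP => [->|_].
        by rewrite leNgt x2 x1.
      by have := xK j; rewrite [(a0 + _) _ _]mxE.
    by rewrite leb_box box_vol_setrow opprB addrCA subrr addr0 max_l // ltW.
  have q0 : 0 <= 4 / e by rewrite divr_ge0 // ltW.
  pose h (x : T) : R := 4 / e * \1_S x.
  have iS : mu.-integrable E (EFin \o h).
    apply: (integrable_bounded L0 mE EK (M := 4 / e)).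
      by apply: measurable_funM => //; exact: measurable_indic.
    move=> x _; rewrite normrM (ger0_norm q0) indicE.
    by case: (_ \in _); rewrite ?normr1 ?normr0 ?mulr1 ?mulr0.
  have ipsi := integrable_continuous L0 mE EK (continuous_divergence Hpsi).
  have le1 x : F n x <= divergence psi x + h x.
    rewrite /h dpsi -/e -addrA lerDl (bigD1 i) //= big1 => [|j /negPf ji]; last first.
      by rewrite derive_ramp ji mulr0.
    rewrite derive_ramp eqxx addr0 ramp_argument.
    have phi1 : `|phi x ord0 i| <= 1.
      have [_ _ _ /(_ x)] := Hphi; rewrite (bigD1 i) //= => H.
      rewrite -(ler_pXn2r (n := 2)) ?nnegrE // expr1n real_normK ?num_real //.
      apply: le_trans H; rewrite lerDl; apply: sumr_ge0 => j _; exact: sqr_ge0.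
    have /andP[d0 d4] := dcutoff_bound ((c - (x : V) ord0 i) / e).
    rewrite indicE; have [xS|xS] := boolP (x \in S).
      suff : phi x ord0 i * (e^-1 * dcutoff ((c - (x : V) ord0 i) / e)) <= 4 / e.
        by rewrite mulr1 mulNr mulrN; lra.
      apply: (le_trans (ler_norm _)); rewrite normrM -[leRHS]mul1r ler_pM //.
      have iv : 0 <= e^-1 by rewrite invr_ge0 ltW.
      by rewrite (ger0_norm (mulr_ge0 iv d0)) [4 / e]mulrC ler_wpM2l.
    rewrite mulr0 addr0; suff -> : dcutoff ((c - (x : V) ord0 i) / e) = 0 by rewrite !mulr0.
    apply: dcutoff_out; move/negP: xS; rewrite inE => nS.
    have [xc|cx] := ltP ((x : V) ord0 i) c; last by left; rewrite mulr_le0_ge0 ?subr_le0 // ltW // invr_gt0.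
    right; rewrite ler_pdivlMr // mul1r leNgt; apply/negP => H; apply: nS; split => //.
    by rewrite /halfspace /=; apply/negP; rewrite -leNgt; lra.
  apply: (@le_trans _ _ (\int[mu]_(x in E) ((EFin \o divergence psi) \+ (EFin \o h)) x)%E).
    apply: le_integral => //; [exact: iF|exact: integrableD|].
    by move=> x _; rewrite /= -EFinD lee_fin; exact: le1.
  rewrite integralD_EFin // EFinD; apply: leeD.
    by apply: le_trans Ep; exact: perimeter_ge.
  have i1 : mu.-integrable E (EFin \o (\1_S : T -> R)).
    apply: (integrable_bounded L0 mE EK (M := 1)); first exact: measurable_indic.
    by move=> x _; rewrite indicE; case: (_ \in _); rewrite ?normr1 ?normr0.
  rewrite (_ : EFin \o h = (fun x : T => (4 / e)%:E * (\1_S x)%:E)%E); last first.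
    by apply/funext => x /=; rewrite EFinM.
  rewrite integralZl // integral_indic // setIC /= -(massE L0 mES ESK) -EFinM lee_fin.
  have : 4 / e * mass (E `&` S) <= 4 / e * (e * C) by rewrite ler_wpM2l.
  by rewrite mulrA divfK // gt_eqF.
pose G (x : T) : R := \1_(halfspace i c) x * divergence phi x.
have mG : measurable_fun E (EFin \o G).
  apply/measurable_EFinP; apply: measurable_funM; first exact: measurable_indic.
  exact: (measurable_fun_continuous L0 mE EK cf).
have cvF : {ae mu, forall x, E x -> (EFin \o F n) x @[n --> \oo] -->
    (EFin \o G) x}.
  apply: aeW => x _; apply: cvg_EFin; first by apply: nearW.
  apply: cvgMl; exact: ramp_cvg.
have bF : {ae mu, forall x n, E x -> (`|(EFin \o F n) x| <= M%:E)%E}.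
  apply: aeW => x n Ex; rewrite /= lee_fin normrM.
  have /andP[r0 r1] := ramp_bound i c n.+1%:R^-1 x.
  by rewrite (ger0_norm r0) -[leRHS]mul1r ler_pM // fM //; exact: EK.
have iM : mu.-integrable E (fun=> M%:E).
  by apply: (integrable_bounded L0 mE EK (M := M)) => // x _; rewrite ger0_norm.
have mF n : measurable_fun E (EFin \o F n) by case/integrableP: (iF n).
have [_ _ cv] := dominated_convergence mE mF mG cvF iM bF.
have -> : (\int[mu]_(x in E `&` halfspace i c) (divergence phi x)%:E =
    \int[mu]_(x in E) (EFin \o G) x)%E.
  rewrite integral_mkcondr; apply: eq_integral => x _ /=; rewrite patchE /G indicE.
  by case: (_ \in _); rewrite ?mul1r ?mul0r.
rewrite -(cvg_lim _ cv) //; apply: lime_le; first by apply/cvg_ex; eexists; exact: cv.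
by apply: nearW.
Qed.

Lemma finite_perimeter_cell (E : set T) l a : measurable E -> E `<=` K ->
  finite_perimeter E -> finite_perimeter (E `&` cell l a).
Proof.
move=> mE EK fE.
(* The cell constraints are imposed one coordinate at a time, each costing two half-spaces. *)
pose S (s : seq 'I_N) : set T := [set x | E x /\
  forall i, i \in s -> a ord0 i <= (x : V) ord0 i < a ord0 i + width l ord0 i].
have -> : E `&` cell l a = S (enum 'I_N).
  apply/seteqP; split=> [x [Ex xa]|x [Ex xa]].
    by split => // i _; exact: xa.
  by split => // i; apply: xa; rewrite mem_enum.
suff : measurable (S (enum 'I_N)) /\ finite_perimeter (S (enum 'I_N)) by case.
elim: (enum 'I_N) => [|i s [mS fS]].
  by rewrite (_ : S [::] = E) //; apply/seteqP; split=> x // [].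
have SK : S s `<=` K by move=> x [/EK].
pose H1 := halfspace i (a ord0 i + width l ord0 i); pose H2 := halfspace i (a ord0 i).
have mH1 : measurable H1 by exact: measurable_halfspace.
have mH2 : measurable H2 by exact: measurable_halfspace.
have -> : S (i :: s) = (S s `&` H1) `\` H2.
  apply/seteqP; split=> [x [Ex xs]|x [[[Ex xs] x1] /negP x2]].
    have /andP[x1 x2] := xs i (mem_head _ _); split; last by apply/negP; rewrite -leNgt.
    by split => //; split => // j js; apply: xs; rewrite inE js orbT.
  split => // j; rewrite inE => /orP[/eqP ->|]; last exact: xs.
  by rewrite leNgt x2 x1.
have mS1 := measurableI _ _ mS mH1; have S1K : S s `&` H1 `<=` K by move=> x [/SK].
split; first exact: measurableD.
have f1 := finite_perimeter_halfspace i (a ord0 i + width l ord0 i) mS SK fS.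
by apply: finite_perimeter_setD => //; exact: finite_perimeter_halfspace.
Qed.

Lemma cellvolE l : cellvol l = cellvol 0 / 2 ^+ l.
Proof.
elim: l => [|l IH]; first by rewrite expr0 divr1.
by rewrite cellvolS IH exprSr invfM mulrA.
Qed.

(** Two different indices would contribute 2 to the sum of the indicators of the cells at [x], which
    is at most 1. Comparing indices also rules out repetitions in the list. *)
Lemma cell_nth_disjoint l (p : pred V) i j (x : T) :
  let s := [seq a <- corners l | p a] in
  (i < size s)%N -> (j < size s)%N -> cell l (nth 0 s i) x -> cell l (nth 0 s j) x -> i = j.
Proof.
move=> s si sj xi xj; apply/eqP; apply: contraT => ij.
have F0 (a : V) : 0 <= \1_(cell l a) x :> R by rewrite indicE; case: (_ \in _).
have : \sum_(a <- s) \1_(cell l a) x <= 1 :> R.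
  apply: (@le_trans _ _ (\sum_(a <- corners l) \1_(cell l a) x)); last first.
    by rewrite (sum_indic_corners i0 a0 L0) indicE; case: (_ \in _).
  by rewrite big_filter big_mkcond; apply: ler_sum => a _; case: (p a).
rewrite (big_nth 0) big_mkord (bigD1 (Ordinal si)) //= (bigD1 (Ordinal sj)) /=; last first.
  by rewrite -val_eqE /= eq_sym.
rewrite !indicE !mem_set // addrA leNgt; case/negP.
rewrite -[ltLHS]addr0 ltr_leD //; first by rewrite ltrDl.
by apply: sumr_ge0 => k _.
Qed.

(** When k cells have less volume than [E], more than k cells meet [E] in positive measure. The
    conclusion on perimeters is conditional so that the lemma also serves the degenerate case. *)
Lemma split_tuple (E : set T) (k : nat) : measurable E -> E `<=` K -> 0 < mass E ->
  exists2 F : 'I_k -> set T, Ek E F &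
    finite_perimeter E -> forall i, finite_perimeter (F i).
Proof.
move=> mE EK E0.
have [l kl] : exists l, k%:R * cellvol l < mass E.
  have [l Hl] : exists l : nat, k%:R * cellvol 0 / mass E < l%:R.
    by exists (Num.truncn (k%:R * cellvol 0 / mass E)).+1; exact: truncnS_gt.
  exists l; rewrite cellvolE mulrA ltr_pdivrMr ?exprn_gt0 //.
  move: Hl; rewrite ltr_pdivrMr // => /lt_trans; apply.
  by rewrite mulrC ltr_pM2l // -natrX ltr_nat ltn_expl.
pose s := [seq a <- corners l | 0 < part E l a].
have ks : (k < size s)%N.
  rewrite -(ltr_nat R) -(ltr_pM2r (cellvol_gt0 i0 L0 l)); apply: (lt_le_trans kl).
  rewrite -(part_self EK) -(sum_part i0 a0 L0 l mE).
  rewrite (bigID (fun a => 0 < part E l a)) /= [X in _ + X]big1 ?addr0 => [|a]; last first.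
    by rewrite -leNgt => aE; apply/eqP; rewrite eq_le aE part_ge0.
  rewrite -big_filter -/s -sum1_size natr_sum mulr_suml; apply: ler_sum => a _.
  by rewrite mul1r (part_le i0 L0).
exists (fun i : 'I_k => E `&` cell l (nth 0 s i)).
  split=> [i|i j ij].
    have mc := measurable_cell i0 L l (nth 0 s i); split; [exact: measurableI|by move=> x []|].
    rewrite -(partE i0 L0) // lte_fin.
    have := mem_nth 0 (ltn_trans (ltn_ord i) ks); rewrite mem_filter => /andP[] //.
  rewrite -subset0 => x [[_ xi] [_ xj]].
  have := cell_nth_disjoint (ltn_trans (ltn_ord i) ks) (ltn_trans (ltn_ord j) ks) xi xj.
  by move/val_inj/eqP; rewrite (negPf ij).
by move=> fE i; exact: finite_perimeter_cell.
Qed.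

End Cutting.

(** * Leximin tuples *)

Section Leximin.
Context (R : realType) (k : nat) (lam : R).
Local Notation W := 'rV[R]_k.

(** The max-min formula for the j-th largest entry, whose continuity is immediate. The defaults [0]
    and [lam] are neutral for entries between them. *)
Definition kth_largest (j : nat) (r : W) : R :=
  \big[Num.max/0]_(S : {set 'I_k} | #|S| == j) \big[Num.min/lam]_(i in S) r ord0 i.

Lemma continuous_kth_largest j : continuous (kth_largest j).
Proof.
have cmax : continuous (fun x : R * R => Num.max x.1 x.2).
  move=> x; apply: (@continuous_max R^o (R * R)%type fst snd); [exact: cvg_fst|exact: cvg_snd].
have cmin : continuous (fun x : R * R => Num.min x.1 x.2).
  move=> x; apply: (@continuous_min R^o (R * R)%type fst snd); [exact: cvg_fst|exact: cvg_snd].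
move=> r; have FF : Filter (nbhs r) := nbhs_filter r.
apply: (@cvg_big R _ Num.max 0 _ cmax W (nbhs r) _ _ _ FF) => S _.
apply: (@cvg_big R _ Num.min lam _ cmin W (nbhs r) _ _ _ FF) => i _.
exact: coord_continuous.
Qed.

(** Turns comparisons of sorted entries into cardinalities. Positivity of [t] excludes the default
    0, which is the value of [kth_largest] when [j > k]. *)
Lemma le_kth_largest j t (r : W) : 0 < t -> (0 < j)%N -> (forall i, r ord0 i <= lam) ->
  (t <= kth_largest j r) = (j <= #|[set i | (t <= r ord0 i)%R]%SET|)%N.
Proof.
move=> t0 j0 rlam; apply/idP/idP => [|jt].
  apply: contraTT; rewrite -ltnNge -ltNge => cj.
  apply: bigmax_lt => // S /eqP Sj; rewrite ltNge; apply/negP => /bigmin_geP[_ HS].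
  move: cj; rewrite -Sj ltnNge; case/negP; apply: subset_leq_card.
  by apply/fintype.subsetP => i /HS; rewrite finset.in_set.
have [S SA Sj] : exists2 S : {set 'I_k}, S \subset [set i | (t <= r ord0 i)%R]%SET & #|S| = j.
  exists [set x in take j (enum [set i | (t <= r ord0 i)%R]%SET)]%SET.
    by apply/fintype.subsetP => i; rewrite finset.in_set => /mem_take; rewrite mem_enum.
  by rewrite cardsE (card_uniqP (take_uniq _ (enum_uniq _))) size_takel // -cardE.
apply: (bigmax_sup S); first exact/eqP.
have HS i : i \in S -> t <= r ord0 i by move/(fintype.subsetP SA); rewrite finset.in_set.
apply/bigmin_geP; split => //.
have /card_gt0P[i iS] : (0 < #|S|)%N by rewrite Sj.
exact: le_trans (HS _ iS) (rlam i).
Qed.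

(** [D] is obtained by minimizing [f 0], ..., [f n.-1] in turn, each over the minimizers of the
    previous ones. No point of [C] can then be weakly below on an initial segment without being
    equal there; the clause for [m = n] carries the induction. *)
Lemma lexicographic_min (X : topologicalType) (C : set X) (f : nat -> X -> R) n :
  compact C -> C !=set0 -> (forall j, continuous (f j)) ->
  exists D, [/\ compact D, D !=set0, D `<=` C & forall r r', D r -> C r' ->
    forall m, (m <= n)%N -> (forall j, (j < m)%N -> f j r' <= f j r) ->
    (forall j, (j < m)%N -> f j r' = f j r) /\ (m = n -> D r')].
Proof.
move=> cC C0 cf; elim: n => [|n [D [cD D0 DC HD]]].
  exists C; split => // r r' Cr Cr' m; rewrite leqn0 => /eqP -> _; by split.
have [c cinD cmin] := compact_EVT_min D0 cD (continuous_subspaceT (cf n)).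
have Dc : D c by move: cinD; rewrite inE.
exists (D `&` [set x | f n x <= f n c]); split.
- apply: compact_closedI => //.
  have -> : [set x | f n x <= f n c] = f n @^-1` [set y | y <= f n c] by [].
  by apply: closed_comp => [x _|]; [exact: cf|exact: closed_le].
- by exists c; split => /=.
- by move=> x [/DC].
move=> r r' [Dr rc] Cr' m; rewrite leq_eqVlt => /orP[/eqP ->|]; last first.
  rewrite ltnS => mn H; have [H1 _] := HD _ _ Dr Cr' m mn H; split => // mE.
  by move: mn; rewrite mE ltnn.
move=> H; have [H1 /(_ erefl) Dr'] := HD _ _ Dr Cr' n (leqnn n) (fun j jn => H j (leqW jn)).
have E : f n r' = f n r.
  apply/eqP; rewrite eq_le H //=; apply: (le_trans rc); apply: cmin; by rewrite inE.
split=> [j|_]; last by split => //; rewrite /= E.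
by rewrite ltnS leq_eqVlt => /orP[/eqP -> //|]; exact: H1.
Qed.

(* If r' lies below r_i0 in some coordinates, including i0, and below r in the
   others, then with p the number of coordinates of r that are at least r_i0, the
   first p largest entries of r' are at most those of r and the p-th is smaller. *)
Lemma leximin (C : set W) : compact C -> C !=set0 ->
  (forall r, C r -> forall i, 0 <= r ord0 i <= lam) ->
  exists2 r, C r & forall r' i0, C r' ->
    (forall i, r' ord0 i < r ord0 i0 \/ (i != i0 /\ r' ord0 i <= r ord0 i)) -> False.
Proof.
move=> cC C0 Clam.
have [D [_ [r Dr] DC HD]] := lexicographic_min k cC C0
  (fun j => @continuous_kth_largest j.+1).
exists r => [|r' i0 Cr' H]; first exact: DC.
have Cr := DC _ Dr; pose p := #|[set i | (r ord0 i0 <= r ord0 i)%R]%SET|.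
have rlam i : r ord0 i <= lam by case/andP: (Clam _ Cr i).
have r'lam i : r' ord0 i <= lam by case/andP: (Clam _ Cr' i).
have m0 : 0 < r ord0 i0.
  have [/(le_lt_trans _)|[]] := H i0; last by rewrite eqxx.
  by apply; case/andP: (Clam _ Cr' i0).
have p0 : (0 < p)%N by apply/card_gt0P; exists i0; rewrite finset.in_set.
have pk : (p <= k)%N by rewrite -[k in leqRHS]card_ord; exact: max_card.
have up t i : r ord0 i0 <= t -> t <= r' ord0 i -> i != i0 /\ t <= r ord0 i.
  move=> mt tr'; have [lt|[ii0 le]] := H i.
    by have := lt_le_trans lt (le_trans mt tr'); rewrite ltxx.
  by split => //; exact: le_trans le.
have le_all j : (j < p)%N -> kth_largest j.+1 r' <= kth_largest j.+1 r.
  move=> jp; have [t0|t0] := leP (kth_largest j.+1 r') 0.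
    apply: (le_trans t0); exact: bigmax_ge_id.
  rewrite le_kth_largest //.
  have : (j.+1 <= #|[set i | (kth_largest j.+1 r' <= r' ord0 i)%R]%SET|)%N.
    by rewrite -le_kth_largest.
  (* Above the threshold [r ord0 i0], entries of r' are dominated by those of r at the same places;
     below it, the [p] entries of r counted by definition suffice. *)
  move: (kth_largest j.+1 r') t0 => t t0; have [mt /leq_trans|tm _] := leP (r ord0 i0) t.
    apply; apply: subset_leq_card; apply/fintype.subsetP => i.
    by rewrite !finset.in_set => /(up _ _ mt)[].
  apply: (leq_trans jp); apply: subset_leq_card; apply/fintype.subsetP => i.
  by rewrite !finset.in_set; apply: le_trans; exact: ltW.
have [eqs _] := HD _ _ Dr Cr' p pk le_all.
have pp : (p.-1 < p)%N by rewrite prednK.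
have := eqs _ pp; rewrite prednK // => E.
(* Equality of the [p]-th largest entries would give r' as many entries at least [r ord0 i0] as r
   has; but these places form a proper subset, as [i0] is lost. *)
have : (p <= #|[set i | (r ord0 i0 <= r' ord0 i)%R]%SET|)%N.
  by rewrite -le_kth_largest // E le_kth_largest.
rewrite leqNgt; case/negP; apply: proper_card; apply/fintype.properP; split.
  by apply/fintype.subsetP => i; rewrite !finset.in_set => /(up _ _ (lexx _))[].
exists i0; rewrite finset.in_set // -ltNge.
by have [//|[]] := H i0; rewrite eqxx.
Qed.

End Leximin.

(** * From leximin vectors to adjusted tuples *)

Section Adjusted.
Context (R : realType) (N : nat) (i0 : 'I_N) (a0 : 'rV[R]_N) (L : R) (L0 : 0 < L).
Local Notation V := 'rV[R]_N.
Local Notation T := (leb_space R N).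
Local Notation mu := (@leb R N).
Local Notation cell := (cell i0 L).
Local Notation K := (cell 0 a0).
Local Notation ratio := (@Defs.ratio R N).

Lemma ratio_ge0 (E : set T) : (0 <= ratio E)%E.
Proof.
by apply: mule_ge0; [exact: (perimeter_ge0 i0)|rewrite lee_fin invr_ge0 mass_ge0].
Qed.

Lemma ratio_infinite (E : set T) : 0 < mass E -> ~ finite_perimeter E -> ratio E = +oo%E.
Proof.
move=> E0 nE; rewrite /Defs.ratio; have := perimeter_ge0 i0 E.
case EP : (perimeter E) => [p| |] // _; last by rewrite gt0_mulye // lte_fin invr_gt0.
by case: nE; exists p; rewrite EP.
Qed.

Lemma cheeger_tupleP (D : set T) k (E : 'I_k -> set T) : Ek D E ->
  (forall F : 'I_k -> set T, Ek D F -> forall i, (ratio (E i) <= maxratio F)%E) ->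
  cheeger_tuple D E.
Proof.
move=> DE HE; split => //; apply/eqP; rewrite eq_le; apply/andP; split.
  apply: le_ereal_inf_tmp => _ [F DF <-].
  by apply: bigmax_le => [|i _]; [exact: leNye|exact: HE].
by apply: ereal_inf_lbound; exists E.
Qed.

Lemma Ek_restrict (Om : set T) k l (E : 'I_k -> set T) (s : 'I_l -> 'I_k) :
  injective s -> Ek Om E -> Ek (Om `\` \bigcup_(j in ~` range s) E j) (E \o s).
Proof.
move=> si [HE dE]; split=> [q|p q pq] /=.
  have [mE EO E0] := HE (s q); split => // x Ex; split; first exact: EO.
  move=> [j /= js Ej]; have sj : s q != j by apply/eqP => sqj; apply: js; exists q.
  by have := dE _ _ sj; rewrite -subset0; apply; split; [exact: Ex|exact: Ej].
by apply: dE; apply: contra_neq pq => /si.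
Qed.

Definition replace k l (E : 'I_k -> set T) (s : 'I_l -> 'I_k) (F : 'I_l -> set T) (j : 'I_k) :=
  if [pick q | s q == j] is Some q then F q else E j.

(** The new sets avoid the ones that are kept because they lie in the complement of their union. *)
Lemma Ek_replace (Om : set T) k l (E : 'I_k -> set T) (s : 'I_l -> 'I_k) (F : 'I_l -> set T) :
  Ek Om E -> Ek (Om `\` \bigcup_(j in ~` range s) E j) F -> Ek Om (replace E s F).
Proof.
move=> [HE dE] [HF dF]; split=> [i|i j ij]; rewrite /replace.
  case: pickP => [q _|_]; last exact: HE.
  by have [mF FO F0] := HF q; split => // x /FO[].
have FE q j' : (forall q, (s q == j') = false) -> F q `&` E j' = set0.
  move=> nj; rewrite -subset0 => x [Fx Ex]; have [_ /(_ x Fx)[_ nU] _] := HF q; apply: nU.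
  by exists j' => //= -[p _ /eqP]; rewrite nj.
case: pickP => [p /eqP sp|ni]; case: pickP => [q /eqP sq|nj].
- by apply: dF; apply: contra_neq ij => pq; rewrite -sp -sq pq.
- exact: FE.
- by rewrite setIC; exact: FE.
- exact: dE.
Qed.

(* Degenerate case: all the ratios are infinite. *)
Lemma infinite_adjusted (Om : set T) k (E : 'I_k -> set T) l (s : 'I_l -> 'I_k) :
  Om `<=` K ->
  (forall D : set T, measurable D -> D `<=` Om -> 0 < mass D -> ~ finite_perimeter D) ->
  Ek Om E -> (0 < l)%N -> injective s ->
  cheeger_tuple (Om `\` \bigcup_(j in ~` range s) E j) (E \o s).
Proof.
move=> OK inf EE l0 si; apply: cheeger_tupleP; first exact: Ek_restrict.
move=> F [HF _] q; apply: (@le_trans _ _ (ratio (F (Ordinal l0)))); last exact: le_bigmax.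
have [mF FO F0] := HF (Ordinal l0).
have FO' : F (Ordinal l0) `<=` Om by move=> x /FO[].
have mF0 : 0 < mass (F (Ordinal l0)) by rewrite (mass_gt0 L0 mF (subset_trans FO' OK)).
by rewrite (ratio_infinite mF0 (inf _ mF FO' mF0)) leey.
Qed.

Lemma finite_adjusted (Om : set T) k (D : set T) :
  Om `<=` K -> measurable D -> D `<=` Om -> 0 < mass D -> finite_perimeter D ->
  exists E : 'I_k -> set T, Ek Om E /\ forall l (s : 'I_l -> 'I_k), (0 < l)%N -> injective s ->
    cheeger_tuple (Om `\` \bigcup_(j in ~` range s) E j) (E \o s).
Proof.
move=> OK mD DO D0 fD.
pose adm : set 'rV[R]_k := [set r | exists2 E : 'I_k -> set T, Ek Om E &
  forall i, (ratio (E i) <= (r ord0 i)%:E)%E].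
have cl_adm : closed adm.
  move=> r rcl.
  have /choice[E HE] n : exists E : 'I_k -> set T, Ek Om E /\
      forall i, (ratio (E i) <= (r ord0 i + n.+1%:R^-1)%:E)%E.
    have n0 : 0 < n.+1%:R^-1 :> R by rewrite invr_gt0.
    have [r' [[E EE HE] rr']] := rcl _ (nbhsx_ballx r _ n0).
    exists E; split => // i; apply: (le_trans (HE i)); rewrite lee_fin.
    case: rr' => _ /(_ ord0 i); rewrite -ball_normE /= ltr_norml => /andP[+ _].
    by rewrite ltrNl opprB ltrBlDl => /ltW.
  have [F EF HF] := tuple_compactness (i0 := i0) (a0 := a0) L0 OK
    (fun n => (HE n).1) (rho := fun i => r ord0 i) (fun n => (HE n).2).
  by exists F.
have [E0 DE0 fE0] := split_tuple L0 k mD (subset_trans DO OK) D0.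
have OE0 : Ek Om E0.
  case: DE0 => H dE; split => // i; have [mE ED Ei] := H i; split => //.
  exact: subset_trans ED DO.
have E0fin i : exists c : R, (ratio (E0 i) <= c%:E)%E.
  have [p Ep] := fE0 fD i; have [mE EO Ei] := OE0.1 i.
  have Em : 0 < mass (E0 i) by rewrite (mass_gt0 L0 mE (subset_trans EO OK)).
  by exists (p / mass (E0 i)); rewrite ratio_le // divfK // gt_eqF.
have [c0 Hc0] := choice E0fin.
(* Large enough for the tuple cut out of [D] to provide a point of [C]. *)
pose lam := \sum_i `|c0 i|.
pose C := [set r : 'rV[R]_k | forall i, (const_mx 0 : 'rV[R]_k) ord0 i <= r ord0 i <=
  (const_mx lam : 'rV[R]_k) ord0 i] `&` adm.
have cC : compact C by apply: compact_closedI => //; exact: compact_box.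
have C0 : C !=set0.
  exists (\row_i `|c0 i|); split => /= [i|].
    rewrite !mxE normr_ge0 /= /lam (bigD1 i) //= lerDl; exact: sumr_ge0.
  exists E0 => // i; rewrite mxE (le_trans (Hc0 i)) // lee_fin; exact: ler_norm.
have Clam r : C r -> forall i, 0 <= r ord0 i <= lam.
  by move=> [Cr _] i; have := Cr i; rewrite !mxE.
have [r Cr Hr] := leximin cC C0 Clam.
have [E EE Er] := Cr.2.
exists E; split => // l s l0 si; apply: cheeger_tupleP; first exact: Ek_restrict.
move=> F DF q /=; rewrite leNgt; apply/negP => FE.
(* All new ratios lie below the one entry at [s q], whatever the old entries at the other replaced
   places; this is the comparison that [leximin] excludes. It also keeps the new vector below
   [lam]. *)
have Fq p : (ratio (F p) < (r ord0 (s q))%:E)%E.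
  apply: lt_le_trans (Er (s q)); apply: le_lt_trans FE; exact: le_bigmax.
have Ffin p : (fine (ratio (F p)))%:E = ratio (F p).
  by rewrite fineK // ge0_fin_numE ?ratio_ge0 // (lt_trans (Fq p)) // ltry.
pose r' : 'rV[R]_k := \row_j if [pick p | s p == j] is Some p then fine (ratio (F p)) else r ord0 j.
have r'lt i : r' ord0 i < r ord0 (s q) \/ (i != s q /\ r' ord0 i = r ord0 i).
  rewrite mxE; case: pickP => [p _|ni]; first by left; rewrite -lte_fin Ffin.
  by right; split => //; have := ni q; rewrite eq_sym => ->.
apply: (Hr r' (s q)) => [|i]; last first.
  by have [|[? ->]] := r'lt i; [left|right].
split=> [i|].
  rewrite !mxE; apply/andP; split.
    case: pickP => [p _|_]; first by rewrite -lee_fin Ffin ratio_ge0.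
    by case/andP: (Clam _ Cr i).
  have := r'lt i; rewrite mxE => -[/ltW H|[_ ->]].
    by apply: (le_trans H); case/andP: (Clam _ Cr (s q)).
  by case/andP: (Clam _ Cr i).
exists (replace E s F); first exact: Ek_replace.
by move=> i; rewrite /replace mxE; case: pickP => [p _|_]; [rewrite Ffin|exact: Er].
Qed.

End Adjusted.

Local Open Scope ereal_scope.

Theorem theorem2p1 (R : realType) (N : nat) (Om : set (leb_space R N)) :
  (2 <= N)%N ->
  measurable Om -> bounded_rN Om -> 0 < leb Om ->
  forall k n : nat, (1 <= n <= k)%N ->
  exists E : 'I_k -> set (leb_space R N), @n_adjusted R N Om k n E.
Proof.
move=> N2 mOm [M OM] Om0 k n /andP[n1 nk].
have i0 : 'I_N := Ordinal (leq_trans (isT : 0 < 2)%N N2).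
(* The margin 1 keeps [Om] off the excluded upper faces of the half-open cube and makes the side
   positive. *)
pose a0 : 'rV[R]_N := const_mx (- (`|M| + 1))%R; pose L : R := (2 * (`|M| + 1))%R.
have L0 : (0 < L)%R by rewrite mulr_gt0 // ltr_wpDl.
have OK : Om `<=` cell i0 L 0 a0.
  move=> x /OM xM i; have := xM i; rewrite /Defs.coord ler_norml !mxE /L.
  by have := ler_norm M; lra.
have mO0 : (0 < mass Om)%R by rewrite (mass_gt0 L0 mOm OK).
have [E [EE HE]] : exists E : 'I_k -> set (leb_space R N), Ek Om E /\
    forall l (s : 'I_l -> 'I_k), (0 < l)%N -> injective s ->
    cheeger_tuple (Om `\` \bigcup_(j in ~` range s) E j) (E \o s).
  have [[D [mD DO D0 fD]]|nD] := pselect (exists D, [/\ measurable D, D `<=` Om,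
      (0 < mass D)%R & finite_perimeter D]).
    exact: (finite_adjusted L0 k OK mD DO D0 fD).
  have [E EE _] := split_tuple L0 k mOm OK mO0.
  exists E; split => // l s l0 si; apply: (infinite_adjusted L0 OK _ EE l0 si).
  by move=> D mD DO D0 fD; apply: nD; exists D.
exists E; split.
  (* The whole tuple is the case [l = k] with the identity selection, where nothing is removed from
     [Om]. *)
  have := HE k id (leq_trans n1 nk) (fun _ _ => id).
  suff -> : Om `\` \bigcup_(j in ~` range (@id 'I_k)) E j = Om by [].
  rewrite (_ : ~` range _ = set0) ?bigcup_set0 ?setD0 // -subset0 => j /= nj.
  by apply: nj; exists j.
by move=> l s /andP[l1 _] si; exact: HE.
Qed.
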